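(* Let $c>0$ be a constant. There exists a constant $C$ depending only on $c$ such that the following holds. Let $p\ge2$, let $V$ be a centered random vector in $\mathbb R^p$ admitting a Stein kernel $\tau:\mathbb R^p\to\mathbb R^{p\times p}$, and let $Z$ be a centered Gaussian random vector in $\mathbb R^p$ with covariance matrix $\Sigma$ such that $\Sigma_{jj}\ge c$ for all $j=1,\dots,p$. Then $$\sup_{y\in\mathbb R^p}\Big|\mathrm P(V\le y)-\mathrm P(Z\le y)\Big|\le C\Big(\Delta\log^2p\Big)^{1/2},\qquad\text{where }\Delta=\mathrm E\left[\max_{1\le j,k\le p}|\tau_{jk}(V)-\Sigma_{jk}|\right].$$
   Context: For $x,y\in\mathbb R^p$, $x\le y$ means $x_j\le y_j$ for all $j$. Let $C_b^2(\mathbb R^p)$ be the class of twice continuously differentiable functions $\varphi$ on $\mathbb R^p$ such that $\varphi$ and all its partial derivatives up to second order are bounded. A measurable function $\tau:\mathbb R^p\to\mathbb R^{p\times p}$ is a Stein kernel for a centered random vector $V$ in $\mathbb R^p$ if $$\sum_{j=1}^p\mathrm E[\partial_j\varphi(V)V_j]=\sum_{j,k=1}^p\mathrm E[\partial_{jk}\varphi(V)\tau_{jk}(V)]\quad\text{for all }\varphi\in C_b^2(\mathbb R^p).$$ *)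

(* Defs.v *)
From HB Require Import structures.
From mathcomp Require Import all_boot all_order all_algebra.
From mathcomp Require Import all_classical all_reals all_analysis.

Set Implicit Arguments.
Unset Strict Implicit.
Unset Printing Implicit Defensive.

Import Order.TTheory GRing.Theory Num.Theory.
Import numFieldNormedType.Exports.

Local Open Scope classical_set_scope.
Local Open Scope ring_scope.

                                                                        
                                         
Notation borelM R m n :=
  (g_sigma_algebraType (@open 'M[R]_(m, n))).
Notation borelV R n := (borelM R 1 n).

Definition coord (R : realType) (T : Type) (p : nat) (V : T -> 'rV[R]_p)
    (j : 'I_p) : T -> R :=
  fun w => V w ord0 j.

Definition centered (R : realType) (d : measure_display) (T : measurableType d)
    (P : probability T R) (p : nat) (V : T -> 'rV[R]_p) : Prop :=
  forall j : 'I_p,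
    P.-integrable [set: T] (EFin \o coord V j) /\
    'E_P[coord V j]%E = 0%E.

Definition has_covariance (R : realType) (d : measure_display)
    (T : measurableType d) (P : probability T R) (p : nat)
    (V : T -> 'rV[R]_p) (Sigma : 'M[R]_p) : Prop :=
  forall j k : 'I_p,
    covariance P (coord V j) (coord V k) = (Sigma j k)%:E.

                                                                           
                                            
Definition std_gaussian (R : realType) (d : measure_display)
    (T : measurableType d) (P : probability T R) (m : nat)
    (N : T -> 'rV[R]_m) : Prop :=
  forall B : 'I_m -> set R, (forall i, measurable (B i)) ->
    P [set w | forall i, B i (N w ord0 i)] =
    (\prod_(i < m) normal_prob 0 1 (B i))%E.

                                                                              
                                                                              
                                                           
Definition gaussian_vector (R : realType) (d : measure_display)
    (T : measurableType d) (P : probability T R) (p : nat)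
    (Z : T -> 'rV[R]_p) : Prop :=
  exists (m : nat) (A : 'M[R]_(m, p)) (b : 'rV[R]_p)
         (d' : measure_display) (T' : measurableType d') (P' : probability T' R)
         (N : {RV P' >-> borelV R m}),
    std_gaussian P' N /\
    forall B : set (borelV R p), measurable B ->
      P [set w | B (Z w)] = P' [set w | B ((N w : 'rV[R]_m) *m A + b)].

Definition partial (R : realType) (p : nat) (j : 'I_p) (f : 'rV[R]_p -> R)
    : 'rV[R]_p -> R :=
  fun x => 'D_(delta_mx ord0 j) f x.

Definition has_partial (R : realType) (p : nat) (j : 'I_p) (f : 'rV[R]_p -> R)
    : Prop :=
  forall x, derivable f x (delta_mx ord0 j).

Definition Cb (R : realType) (p : nat) (f : 'rV[R]_p -> R) : Prop :=
  continuous f /\ bounded_fun f.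

Definition Cb2 (R : realType) (p : nat) (f : 'rV[R]_p -> R) : Prop :=
  [/\ Cb f,
      forall j, has_partial j f /\ Cb (partial j f) &
      forall j k, has_partial j (partial k f) /\ Cb (partial j (partial k f))].

                                                                             
                                                                
Definition stein_kernel (R : realType) (d : measure_display)
    (T : measurableType d) (P : probability T R) (p : nat)
    (V : T -> 'rV[R]_p) (tau : 'rV[R]_p -> 'M[R]_p) : Prop :=
  measurable_fun [set: borelV R p] (tau : borelV R p -> borelM R p p) /\
  forall phi : 'rV[R]_p -> R, Cb2 phi ->
    [/\ forall j, P.-integrable [set: T]
          (fun w => (partial j phi (V w) * V w ord0 j)%:E),
        forall j k, P.-integrable [set: T]
          (fun w => (partial j (partial k phi) (V w) * tau (V w) j k)%:E) &
        (\sum_(j < p) 'E_P[fun w => (partial j phi (V w) * V w ord0 j)%R] =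
         \sum_(j < p) \sum_(k < p)
           'E_P[fun w => (partial j (partial k phi) (V w) * tau (V w) j k)%R])%E].

                                                      
Definition orthant (R : realType) (T : Type) (p : nat) (V : T -> 'rV[R]_p)
    (y : 'rV[R]_p) : set T :=
  [set w | forall j, V w ord0 j <= y ord0 j].

Definition kolmogorov_dist (R : realType) (p : nat)
    (d : measure_display) (T : measurableType d) (P : probability T R)
    (V : T -> 'rV[R]_p)
    (d' : measure_display) (T' : measurableType d') (Q : probability T' R)
    (Z : T' -> 'rV[R]_p) : \bar R :=
  ereal_sup [set `|P (orthant V y) - Q (orthant Z y)|%E | y in [set: 'rV[R]_p]].

                                                                     
               
Definition stein_discrepancy (R : realType) (d : measure_display)
    (T : measurableType d) (P : probability T R) (p : nat)
    (V : T -> 'rV[R]_p) (tau : 'rV[R]_p -> 'M[R]_p) (Sigma : 'M[R]_p) : \bar R :=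
  ('E_P[fun w => (\big[Num.max/0]_(j < p) \big[Num.max/0]_(k < p)
                    `|tau (V w) j k - Sigma j k|)%R])%E.

(* Main.v *)
(* Normalise the coordinates so that the Gaussian vector is Y = X a with X
   standard normal and unit variances.  The indicator of an orthant is sandwiched
   between functions f(u) = g(F(u) / delta), where F is the soft maximum with
   inverse temperature ln p / delta and g a C^2 step.

   Along the rotation cos th V + sin th Y, Stein's identity for V and Gaussian
   integration by parts for Y give
     d/dth E f = - sin th cos th E (sum_jk f_jk (tau_jk - Sigma_jk)).
   Instead of bounding sum_jk |f_jk| by its supremum, it is bounded by
   (ln p / delta^2) times sum_j w_j k(u_j / delta), w being the softmax weights
   and k(r) = 1 / (1 + r^2).  Conditionally on V, the mean of this weighted bump
   is at most of order sqrt(ln p) delta / sin th (anti-concentration), so that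
   integrating in th yields Delta (ln p)^(3/2) / delta.  The same
   anti-concentration bounds the smoothing error by sqrt(ln p) delta; take
   delta = sqrt(Delta ln p).

   Anti-concentration is integration by parts applied to w_j (atan(u_j / delta) +
   pi / 2): the derivative of the arc tangent is the bump, and the derivative of
   w_j contributes a nonnegative amount since correlations do not exceed 1. *)
Require Import Defs.
From HB Require Import structures.
From mathcomp Require Import all_boot all_order all_algebra.
From mathcomp Require Import all_classical all_reals all_analysis.
From mathcomp Require Import measurable_realfun.
From mathcomp Require Import ring lra.

Set Implicit Arguments.
Unset Strict Implicit.
Unset Printing Implicit Defensive.

Import Order.TTheory GRing.Theory Num.Theory.
Import numFieldNormedType.Exports.

Local Open Scope classical_set_scope.
Local Open Scope ring_scope.

(** A supremum bound on the Hessian would give Delta ln p / delta^2 and, after balancing, only the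
    power 1/3 of Delta. But the Hessian of f vanishes off a boundary layer of width of order delta,
    to which the Gaussian part of the rotation gives conditional mass of order delta: this gains the
    missing power. Since V has no known regularity, bumps are averaged over Y alone, with V entering
    as an arbitrary shift, and the smoothing error is always charged to the Gaussian side.

    The profile k is a Cauchy bump and not a cutoff for two reasons. The Hessian produces a bump at
    F(u) / delta, integration by parts needs bumps at the u_j / delta, and the displacement F(u) -
    u_j is controlled only in softmax mean, by an entropy bound: polynomial tails survive this.
    Moreover the primitive of k is bounded.

    Anti-concentration asks for unit variances only, so that Sigma may be singular; c enters through
    the normalization alone, which multiplies the kernel error by at most 1 / c. *)

(** * One-variable differential calculus *)

(** Serves to differentiate the square of the positive part at its kink: the bound on the Taylor
    remainder becomes a case analysis on signs, with no one-sided limits. *)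
Lemma is_derive_quadratic_error (R : realType) (f : R -> R) (x l C : R) :
  (forall h, `|f (x + h) - f x - l * h| <= C * h ^+ 2) -> is_derive x 1 f l.
Proof.
move=> Hf.
have C0 : 0 <= C.
  by rewrite -[C]mulr1 -(expr1n _ 2); exact: le_trans (normr_ge0 _) (Hf 1).
have cv : h^-1 *: ((f \o shift x) (h *: 1) - f x) @[h --> 0^'] --> l.
  apply/cvgrPdist_le => e e0.
  near=> h.
  have h0 : h != 0 by near: h; exact: nbhs_dnbhs_neq.
  have -> : l - h^-1 *: ((f \o shift x) (h *: 1) - f x) =
            - (h^-1 * (f (x + h) - f x - l * h)).
    rewrite /= /GRing.scale /= mulr1 (addrC h x).
    by field.
  rewrite normrN normrM normfV ler_pdivrMl ?normr_gt0//.
  rewrite (le_trans (Hf h))//.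
  rewrite -real_normK ?num_real// expr2 mulrCA ler_wpM2l//.
  (* The denominator is C + 1 because C may vanish. *)
  have : `|h| <= e / (C + 1).
    near: h; apply: dnbhs0_le; apply: divr_gt0 => //; lra.
  rewrite ler_pdivlMr; last lra.
  by move=> H; apply: le_trans H; rewrite mulrDr mulr1 mulrC lerDl.
split; first by apply/cvg_ex; exists l.
by apply/cvg_lim.
Unshelve. all: by end_near. Qed.

Section pointwise_derivatives.
Variable R : realType.
Implicit Types (f g : R -> R) (x a b k : R).

Lemma is_deriveD_pt f g x a b : is_derive x 1 f a -> is_derive x 1 g b ->
  is_derive x 1 (fun t => f t + g t) (a + b).
Proof. exact: is_deriveD. Qed.

Lemma is_deriveB_pt f g x a b : is_derive x 1 f a -> is_derive x 1 g b ->
  is_derive x 1 (fun t => f t - g t) (a - b).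
Proof. exact: is_deriveB. Qed.

Lemma is_deriveZ_pt f x a k : is_derive x 1 f a ->
  is_derive x 1 (fun t => k * f t) (k * a).
Proof. exact: is_deriveZ. Qed.

Lemma is_deriveM_pt f g x a b : is_derive x 1 f a -> is_derive x 1 g b ->
  is_derive x 1 (fun t => f t * g t) (a * g x + f x * b).
Proof.
move=> df dg; apply: is_derive_eq (is_deriveM df dg) _.
by rewrite /GRing.scale /= addrC [g x * a]mulrC.
Qed.

Lemma is_derive_comp_pt f g x a b : is_derive (g x) 1 f a ->
  is_derive x 1 g b -> is_derive x 1 (fun t => f (g t)) (a * b).
Proof. exact: is_derive1_comp. Qed.

Lemma is_derive_cst_pt (k x : R) : is_derive x 1 (fun=> k) 0.
Proof. exact: is_derive_cst. Qed.

Lemma is_derive_affine_pt (k c x : R) : is_derive x 1 (fun t => k * t + c) k.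
Proof.
apply: is_derive_eq (is_deriveD_pt (is_deriveZ_pt k (is_derive_id x 1))
  (is_derive_cst_pt c x)) _; ring.
Qed.

Lemma is_derive_sum_pt n (h : 'I_n -> R -> R) x (dh : 'I_n -> R) :
  (forall i, is_derive x 1 (h i) (dh i)) ->
  is_derive x 1 (fun t => \sum_(i < n) h i t) (\sum_(i < n) dh i).
Proof.
move=> /is_derive_sum; congr (is_derive _ _ _ _).
by apply/funext => t; rewrite fct_sumE.
Qed.

End pointwise_derivatives.

(** * A spline step and the Cauchy bump *)

Definition pos_part (R : realType) (r : R) : R := Num.max r 0.

(* One minus the integrated quadratic B-spline on the knots 0, 1, 2, 3: a C^2
   step from 1 on ]-oo, 0] to 0 on [3, +oo[, with its two derivatives. *)
Definition spline0 (R : realType) (r : R) : R := locked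
  (1 - (pos_part r ^+ 3 - 3 * pos_part (r - 1) ^+ 3
       + 3 * pos_part (r - 2) ^+ 3 - pos_part (r - 3) ^+ 3) / 6).
Definition spline1 (R : realType) (r : R) : R := locked
  (- (pos_part r ^+ 2 - 3 * pos_part (r - 1) ^+ 2
     + 3 * pos_part (r - 2) ^+ 2 - pos_part (r - 3) ^+ 2) / 2).
Definition spline2 (R : realType) (r : R) : R := locked
  (- (pos_part r - 3 * pos_part (r - 1)
     + 3 * pos_part (r - 2) - pos_part (r - 3))).

(** A translation by d changes this profile by a factor of at most 2 (1 + d^2), and its primitive is
    the bounded arc tangent. The lock keeps the quotient from unfolding. *)
Definition cauchy_bump (R : realType) (r : R) : R := locked ((1 + r ^+ 2)^-1).

Arguments spline0 {R}.
Arguments spline1 {R}.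
Arguments spline2 {R}.

Section spline.
Variable R : realType.
Implicit Types r : R.

Lemma is_derive_pos_part_sqr r :
  is_derive r 1 (fun t => pos_part t ^+ 2) (2 * pos_part r).
Proof.
apply: (@is_derive_quadratic_error _ _ _ _ 1) => h.
rewrite /pos_part /Num.max.
case: ltP => H1; case: ltP => H2; rewrite ler_norml; apply/andP; split; nra.
Qed.

Lemma pos_partM r : r * pos_part r ^+ 2 = pos_part r ^+ 3.
Proof. rewrite /pos_part /Num.max; case: ltP => H1; ring. Qed.

(** The cube is t times the squared positive part, so the product rule reduces it to the square. *)
Lemma is_derive_pos_part_cube r :
  is_derive r 1 (fun t => pos_part t ^+ 3) (3 * pos_part r ^+ 2).
Proof.
rewrite (_ : (fun _ => _) = (fun t => t * pos_part t ^+ 2)); last first.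
  by apply/funext => t; rewrite pos_partM.
have := is_derive_pos_part_sqr r => D.
apply: is_derive_eq (is_deriveM_pt (is_derive_id r 1) D) _.
rewrite /pos_part /Num.max; case: ltP => H1; ring.
Qed.

Lemma continuous_pos_part : continuous (@pos_part R).
Proof.
move=> x; apply: (@continuous_max _ _ id (cst 0)); first exact: cvg_id.
exact: cvg_cst.
Qed.

Lemma is_derive_shift_pt (f : R -> R) r a c : is_derive (r - c) 1 f a ->
  is_derive r 1 (fun t => f (t - c)) a.
Proof.
move=> df; rewrite -[a]mulr1; apply: is_derive_comp_pt => //.
rewrite (_ : (fun _ => _) = (fun t => 1 * t - c)); first exact: is_derive_affine_pt.
by apply/funext => t; rewrite mul1r.
Qed.

Lemma is_derive_spline0 r : is_derive r 1 spline0 (spline1 r).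
Proof.
have D c := is_derive_shift_pt (is_derive_pos_part_cube (r - c)).
rewrite (_ : spline0 = fun t => - 6^-1 * (pos_part t ^+ 3
  - 3 * pos_part (t - 1) ^+ 3 + 3 * pos_part (t - 2) ^+ 3
  - pos_part (t - 3) ^+ 3) + 1); last first.
  by apply/funext => t; rewrite /spline0 -!lock; field.
have H := is_deriveD_pt (is_deriveZ_pt (- 6^-1) (is_deriveB_pt
  (is_deriveD_pt (is_deriveB_pt (is_derive_pos_part_cube r)
    (is_deriveZ_pt 3 (D 1))) (is_deriveZ_pt 3 (D 2))) (D 3)))
  (is_derive_cst_pt 1 r).
apply: is_derive_eq H _.
by rewrite /spline1 -!lock; field.
Qed.

Lemma is_derive_spline1 r : is_derive r 1 spline1 (spline2 r).
Proof.
have D c := is_derive_shift_pt (is_derive_pos_part_sqr (r - c)).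
rewrite (_ : spline1 = fun t => - 2^-1 * (pos_part t ^+ 2
  - 3 * pos_part (t - 1) ^+ 2 + 3 * pos_part (t - 2) ^+ 2
  - pos_part (t - 3) ^+ 2)); last first.
  by apply/funext => t; rewrite /spline1 -!lock; field.
have H := is_deriveZ_pt (- 2^-1) (is_deriveB_pt
  (is_deriveD_pt (is_deriveB_pt (is_derive_pos_part_sqr r)
    (is_deriveZ_pt 3 (D 1))) (is_deriveZ_pt 3 (D 2))) (D 3)).
apply: is_derive_eq H _.
by rewrite /spline2 -!lock; field.
Qed.

Lemma continuous_spline0 : continuous (@spline0 R).
Proof.
by move=> r; apply/differentiable_continuous/derivable1_diffP; case: (is_derive_spline0 r).
Qed.

Lemma continuous_spline1 : continuous (@spline1 R).
Proof.
by move=> r; apply/differentiable_continuous/derivable1_diffP; case: (is_derive_spline1 r).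
Qed.

Lemma continuous_spline2 : continuous (@spline2 R).
Proof.
have C (c : R) : continuous (fun t : R => pos_part (t - c)).
  move=> t; apply: (@continuous_comp _ _ _ (fun t => t - c) (@pos_part R)).
    by apply: cvgB; [exact: cvg_id|exact: cvg_cst].
  exact: continuous_pos_part.
rewrite (_ : spline2 = fun r => - (pos_part r - 3 * pos_part (r - 1)
  + 3 * pos_part (r - 2) - pos_part (r - 3))); last first.
  by apply/funext => r; rewrite /spline2 -lock.
move=> r; apply: (@cvgN _ R^o); apply: cvgB; last exact: C.
apply: cvgD; last by apply: cvgM; [exact: cvg_cst|exact: C].
apply: cvgB; last by apply: cvgM; [exact: cvg_cst|exact: C].
exact: continuous_pos_part.
Qed.

Ltac pos_part_cases := rewrite /pos_part /Num.max;
  (case: ltP => ?); (case: ltP => ?); (case: ltP => ?); (case: ltP => ?).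

Lemma pos_part_eq0 r : r <= 0 -> pos_part r = 0.
Proof. by move=> r0; apply/max_idPr. Qed.

Lemma pos_part_id r : 0 <= r -> pos_part r = r.
Proof. by move=> r0; apply/max_idPl. Qed.

Lemma spline0_eq1 r : r <= 0 -> spline0 r = 1.
Proof. by move=> r0; rewrite /spline0 -!lock !pos_part_eq0; [field|lra..]. Qed.

Lemma spline0_eq0 r : 3 <= r -> spline0 r = 0.
Proof. by move=> r3; rewrite /spline0 -!lock !pos_part_id; [field|lra..]. Qed.

Lemma spline0_bounds r : 0 <= spline0 r <= 1.
Proof.
have [r0|r0] := leP r 0; first by rewrite spline0_eq1// ler01 lexx.
have [r3|r3] := leP 3 r; first by rewrite spline0_eq0// lexx ler01.
rewrite /spline0 -!lock (pos_part_id (ltW r0)) (@pos_part_eq0 (r - 3)); last lra.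
have [r1|r1] := leP r 1.
  rewrite !pos_part_eq0; [|lra..].
  by apply/andP; split; nra.
rewrite (@pos_part_id (r - 1)); last lra.
have [r2|r2] := leP r 2.
  rewrite pos_part_eq0; last lra.
  have s2 : 0 <= (r - 1) ^+ 2 <= 1 by apply/andP; split; nra.
  by apply/andP; split; nra.
rewrite pos_part_id; last lra.
have -> : 1 - (r ^+ 3 - 3 * (r - 1) ^+ 3 + 3 * (r - 2) ^+ 3 - 0 ^+ 3) / 6 =
  (3 - r) ^+ 3 / 6 by field.
have s2 : 0 <= (3 - r) ^+ 2 <= 1 by apply/andP; split; nra.
by apply/andP; split; nra.
Qed.

(** The constant is 10 = 1 + 3^2: on [0, 3] the bump is at least 1/10. *)
Lemma cauchy_bump_majorizes (f : R -> R) r :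
  (r <= 0 \/ 3 <= r -> f r = 0) -> `|f r| <= 1 -> `|f r| <= 10 * cauchy_bump r.
Proof.
move=> f0 f1; rewrite /cauchy_bump -!lock ler_pdivlMr; last nra.
have [r0|r0] := leP r 0; first by rewrite f0 ?normr0; [lra|left].
have [r3|r3] := leP 3 r; first by rewrite f0 ?normr0; [lra|right].
have := normr_ge0 (f r); nra.
Qed.

Lemma spline1_le r : `|spline1 r| <= 10 * cauchy_bump r.
Proof.
apply: cauchy_bump_majorizes.
  case=> r0; first by rewrite /spline1 -!lock !pos_part_eq0; [field|lra..].
  by rewrite /spline1 -!lock !pos_part_id; [field|lra..].
have [r0|r0] := leP r 0.
  rewrite /spline1 -!lock !pos_part_eq0; [|lra..]; rewrite ler_norml; lra.
have [r3|r3] := leP 3 r.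
  rewrite /spline1 -!lock !pos_part_id; [|lra..]; rewrite ler_norml; apply/andP; split; nra.
rewrite /spline1 -!lock (pos_part_id (ltW r0)) (@pos_part_eq0 (r - 3)); last lra.
rewrite ler_norml.
have [r1|r1] := leP r 1.
  rewrite !pos_part_eq0; [|lra..].
  by apply/andP; split; nra.
rewrite (@pos_part_id (r - 1)); last lra.
have [r2|r2] := leP r 2.
  rewrite pos_part_eq0; last lra.
  by apply/andP; split; nra.
rewrite pos_part_id; last lra.
by apply/andP; split; nra.
Qed.

Lemma spline2_le r : `|spline2 r| <= 10 * cauchy_bump r.
Proof.
apply: cauchy_bump_majorizes.
  case=> r0; first by rewrite /spline2 -!lock !pos_part_eq0; [field|lra..].
  by rewrite /spline2 -!lock !pos_part_id; [field|lra..].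
by rewrite ler_norml /spline2 -!lock; apply/andP; split; pos_part_cases; lra.
Qed.

Lemma cauchy_bump_gt0 r : 0 < cauchy_bump r.
Proof. by rewrite /cauchy_bump -!lock invr_gt0; nra. Qed.

Lemma cauchy_bump_le1 r : cauchy_bump r <= 1.
Proof. by rewrite /cauchy_bump -!lock invf_le1; nra. Qed.

Lemma continuous_cauchy_bump : continuous (@cauchy_bump R).
Proof.
rewrite (_ : @cauchy_bump R = fun r => (1 + r ^+ 2)^-1); last first.
  by apply/funext => r; rewrite /cauchy_bump -lock.
move=> r; apply: cvgV; first by rewrite gt_eqF//; have := sqr_ge0 r; lra.
by apply: cvgD; [exact: cvg_cst|exact: exprn_continuous].
Qed.

Lemma is_derive_atan_bump r : is_derive r 1 (fun t => atan t + pi / 2) (cauchy_bump r).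
Proof.
apply: is_derive_eq (is_deriveD_pt (is_derive1_atan r) (is_derive_cst_pt _ r)) _.
by rewrite addr0 /cauchy_bump -lock.
Qed.

Lemma atan_pi_bounds r : 0 <= atan r + pi / 2 <= pi.
Proof.
have := atan_gtNpi2 r; have := atan_ltpi2 r; lra.
Qed.

End spline.

(** * Soft maximum and smoothed orthant indicators *)

Section gradients.
Variables (R : realType) (p : nat).
Implicit Types (h : ('I_p -> R) -> R) (dh : 'I_p -> ('I_p -> R) -> R).

(* The chain rule along differentiable curves is taken as the definition, which
   avoids Frechet derivatives on R^p. *)
Definition has_grad h dh := forall (U : 'I_p -> R -> R) (dU : 'I_p -> R) (t : R),
  (forall j, is_derive t 1 (U j) (dU j)) ->
  is_derive t 1 (fun r => h (U ^~ r)) (\sum_k dh k (U ^~ t) * dU k).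

(** Testing on all measurable families makes composition a mere application and asks for no
    sigma-algebra on the functions ['I_p -> R]; [coordwise_continuous] follows the same pattern with
    topologies. *)
Definition coord_measurable h :=
  forall d (T : measurableType d) (X : 'I_p -> T -> R),
  (forall j, measurable_fun [set: T] (X j)) ->
  measurable_fun [set: T] (fun w => h (X ^~ w)).

Definition coordwise_continuous h :=
  forall (T : topologicalType) (X : 'I_p -> T -> R),
  (forall j, continuous (X j)) -> continuous (fun x => h (X ^~ x)).

Lemma eq_has_grad h dh dh' : (forall k u, dh k u = dh' k u) ->
  has_grad h dh -> has_grad h dh'.
Proof.
move=> E H U dU t dUE; apply: is_derive_eq (H U dU t dUE) _.
by apply: eq_bigr => k _; rewrite E.
Qed.

Lemma has_grad_coord j : has_grad (fun u => u j) (fun k _ => (j == k)%:R).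
Proof.
move=> U dU t dUE; apply: is_derive_eq (dUE j) _.
rewrite (bigD1 j)//= eqxx mul1r big1 ?addr0// => k kj.
by rewrite eq_sym (negbTE kj) mul0r.
Qed.

Lemma has_grad_comp (g g' : R -> R) h dh :
  (forall u, is_derive (h u) 1 g (g' (h u))) -> has_grad h dh ->
  has_grad (fun u => g (h u)) (fun k u => g' (h u) * dh k u).
Proof.
move=> dg H U dU t dUE.
apply: is_derive_eq (is_derive_comp_pt (dg _) (H U dU t dUE)) _.
by rewrite big_distrr/=; apply: eq_bigr => k _; rewrite mulrA.
Qed.

Lemma has_gradM h1 dh1 h2 dh2 : has_grad h1 dh1 -> has_grad h2 dh2 ->
  has_grad (fun u => h1 u * h2 u) (fun k u => dh1 k u * h2 u + h1 u * dh2 k u).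
Proof.
move=> H1 H2 U dU t dUE.
apply: is_derive_eq (is_deriveM_pt (H1 U dU t dUE) (H2 U dU t dUE)) _.
rewrite big_distrl/= big_distrr/= -big_split/=; apply: eq_bigr => k _; ring.
Qed.

Lemma has_gradZ (c : R) h dh : has_grad h dh ->
  has_grad (fun u => c * h u) (fun k u => c * dh k u).
Proof.
move=> H U dU t dUE; apply: is_derive_eq (is_deriveZ_pt c (H U dU t dUE)) _.
by rewrite big_distrr/=; apply: eq_bigr => k _; rewrite mulrA.
Qed.

Lemma has_grad_sum n (h : 'I_n -> ('I_p -> R) -> R)
    (dh : 'I_n -> 'I_p -> ('I_p -> R) -> R) :
  (forall i, has_grad (h i) (dh i)) ->
  has_grad (fun u => \sum_i h i u) (fun k u => \sum_i dh i k u).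
Proof.
move=> H U dU t dUE.
apply: is_derive_eq (is_derive_sum_pt (fun i => H i U dU t dUE)) _.
by rewrite exchange_big; apply: eq_bigr => k _; rewrite big_distrl.
Qed.

End gradients.

Definition sum_exp (R : realType) p (beta : R) (u : 'I_p -> R) : R :=
  \sum_k expR (beta * u k).

Definition softmax (R : realType) p (beta : R) (u : 'I_p -> R) : R :=
  locked (ln (sum_exp beta u) / beta).

Definition softmax_weight (R : realType) p (beta : R) (j : 'I_p)
  (u : 'I_p -> R) : R := locked (expR (beta * u j) / sum_exp beta u).

Arguments softmax {R p}.
Arguments softmax_weight {R p}.

Section softmax.
Variables (R : realType) (p : nat) (beta : R).
Hypotheses (p_gt0 : (0 < p)%N) (beta_gt0 : 0 < beta).
Implicit Types u : 'I_p -> R.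

Local Notation sum_exp := (@sum_exp R p beta).
Local Notation softmax := (@softmax R p beta).
Local Notation softmax_weight := (@softmax_weight R p beta).

Lemma expR_le_sum_exp u j : expR (beta * u j) <= sum_exp u.
Proof.
by rewrite /sum_exp (bigD1 j)//= lerDl sumr_ge0// => k _; exact: expR_ge0.
Qed.

Lemma sum_exp_gt0 u : 0 < sum_exp u.
Proof. exact: lt_le_trans (expR_gt0 _) (expR_le_sum_exp u (Ordinal p_gt0)). Qed.

Lemma softmax_weight_gt0 j u : 0 < softmax_weight j u.
Proof. by rewrite /softmax_weight -lock divr_gt0 ?expR_gt0 ?sum_exp_gt0. Qed.

Lemma softmax_weight_ge0 j u : 0 <= softmax_weight j u.
Proof. exact/ltW/softmax_weight_gt0. Qed.

Lemma sum_softmax_weight u : \sum_j softmax_weight j u = 1.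
Proof.
under eq_bigr do rewrite /softmax_weight -lock.
by rewrite -big_distrl/= divff// gt_eqF// sum_exp_gt0.
Qed.

Lemma softmax_weight_le1 j u : softmax_weight j u <= 1.
Proof.
rewrite /softmax_weight -lock ler_pdivrMr ?sum_exp_gt0// mul1r.
exact: expR_le_sum_exp.
Qed.

Lemma le_softmax u j : u j <= softmax u.
Proof.
rewrite /softmax -lock ler_pdivlMr// mulrC -[X in X <= _]expRK ler_ln ?posrE ?expR_gt0//.
  exact: expR_le_sum_exp.
exact: sum_exp_gt0.
Qed.

(** Each of the p exponentials is at most exp(beta a). For beta = ln p / delta the gap between
    maximum and soft maximum is thus at most delta. *)
Lemma softmax_le u a : (forall j, u j <= a) -> softmax u <= a + ln p%:R / beta.
Proof.
move=> ua; rewrite /softmax -lock ler_pdivrMr// mulrDl divfK ?gt_eqF//.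
rewrite -[a * _]expRK -lnM ?posrE ?expR_gt0 ?ltr0n//.
rewrite ler_ln ?posrE ?sum_exp_gt0//; last by rewrite mulr_gt0 ?expR_gt0 ?ltr0n.
apply: (@le_trans _ _ (\sum_(k < p) expR (a * beta))).
  by apply: ler_sum => k _; rewrite ler_expR mulrC ler_pM2r.
by rewrite sumr_const card_ord mulr_natr.
Qed.

(** Moving the threshold of the step amounts to moving the corner of the orthant along the diagonal;
    one bound uniform in the corner then serves both sides of the sandwich. *)
Lemma softmax_shift u a : softmax (fun j => u j - a) = softmax u - a.
Proof.
rewrite /softmax -!lock (_ : sum_exp _ = sum_exp u * expR (- (beta * a))).
  rewrite lnM ?posrE ?sum_exp_gt0 ?expR_gt0// expRK mulrDl; congr (_ + _).
  by rewrite mulNr mulrC mulKf// gt_eqF.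
rewrite /sum_exp big_distrl/=; apply: eq_bigr => k _.
by rewrite -expRD mulrBr.
Qed.

Lemma has_grad_sum_exp :
  has_grad sum_exp (fun k u => beta * expR (beta * u k)).
Proof.
have H (j : 'I_p) := has_grad_comp (fun u => is_derive_expR (beta * u j))
  (has_gradZ beta (has_grad_coord j)).
apply: eq_has_grad (has_grad_sum H) => k u /=.
rewrite (bigD1 k)//= eqxx big1 ?addr0.
  by rewrite mulr1 mulrC.
by move=> j jk; rewrite (negbTE jk) !mulr0.
Qed.

Lemma has_grad_softmax : has_grad softmax softmax_weight.
Proof.
have H := has_gradZ beta^-1
  (has_grad_comp (fun u => is_derive1_ln (sum_exp_gt0 u)) has_grad_sum_exp).
rewrite (_ : softmax = fun u => beta^-1 * ln (sum_exp u)); last first.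
  by apply/funext => u; rewrite /softmax -!lock mulrC.
apply: eq_has_grad H => k u; rewrite /softmax_weight -!lock.
by field; rewrite !gt_eqF ?sum_exp_gt0.
Qed.

Lemma has_grad_softmax_weight j : has_grad (softmax_weight j)
  (fun k u => beta * softmax_weight j u * ((j == k)%:R - softmax_weight k u)).
Proof.
have H1 := has_grad_comp (fun u => is_derive_expR (beta * u j))
  (has_gradZ beta (has_grad_coord j)).
have dV (x : R) : 0 < x -> is_derive x 1 (fun x => x^-1) (- x ^- 2).
  move=> x0; apply: is_derive_eq (is_deriveV _ (is_derive_id x 1)) _.
    by rewrite gt_eqF.
  by rewrite /GRing.scale /= mulr1.
have H2 := has_grad_comp (g' := fun x => - x ^- 2) (fun u => dV _ (sum_exp_gt0 u)) has_grad_sum_exp.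
rewrite (_ : softmax_weight j = fun u => expR (beta * u j) * (sum_exp u)^-1); last first.
  by apply/funext => u; rewrite /softmax_weight -lock.
apply: eq_has_grad (has_gradM H1 H2) => k u /=; rewrite /softmax_weight -!lock.
by field; rewrite gt_eqF ?sum_exp_gt0.
Qed.

Lemma softmax_sub_weight u j :
  softmax u - u j = - ln (softmax_weight j u) / beta.
Proof.
rewrite /softmax /softmax_weight -!lock lnM ?posrE ?expR_gt0 ?invr_gt0 ?sum_exp_gt0//.
rewrite expRK lnV ?posrE ?sum_exp_gt0//.
by field; rewrite gt_eqF.
Qed.

(* The left-hand side times beta is the entropy of the softmax weights. *)
Lemma softmax_weight_entropy_le u :
  \sum_j softmax_weight j u * (softmax u - u j) <= ln p%:R / beta.
Proof.
have p0 : 0 < p%:R :> R by rewrite ltr0n.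
rewrite ler_pdivlMr// big_distrl/= -subr_le0.
have -> : ln p%:R = \sum_j softmax_weight j u * ln p%:R.
  by rewrite -big_distrl/= sum_softmax_weight mul1r.
rewrite -sumrB.
(* Termwise this is ln x <= x - 1 at x = 1 / (p w_j), multiplied by w_j; the bounds add up to 1 - 1
   = 0. *)
apply: (@le_trans _ _ (\sum_j (p%:R^-1 - softmax_weight j u))).
  apply: ler_sum => j _; rewrite softmax_sub_weight.
  move: (softmax_weight j u) (softmax_weight_gt0 j u) => w w0.
  have -> : w * (- ln w / beta) * beta - w * ln p%:R = w * ln (w * p%:R)^-1.
    rewrite lnV ?posrE ?mulr_gt0// lnM ?posrE//; by field; rewrite gt_eqF.
  have -> : p%:R^-1 - w = w * ((w * p%:R)^-1 - 1).
    by field; rewrite !gt_eqF.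
  rewrite ler_pM2l// -[X in ln X](subrKC 1) le_ln1Dx//.
  by rewrite ltrBrDl subrr invr_gt0 mulr_gt0.
rewrite sumrB sum_softmax_weight sumr_const card_ord -(mulr_natr p%:R^-1).
by rewrite mulVf ?subrr// gt_eqF.
Qed.


Lemma coord_measurable_sum_exp : coord_measurable sum_exp.
Proof.
move=> d T X mX; apply: measurable_sum => k.
apply: measurableT_comp => //; exact: measurable_funM.
Qed.

Lemma coord_measurable_softmax : coord_measurable softmax.
Proof.
move=> d T X mX; under eq_fun do rewrite /softmax -lock.
apply: measurable_funM => //.
by apply: measurableT_comp => //; exact: coord_measurable_sum_exp.
Qed.

(** A form without denominator, from which measurability and continuity of the weights follow by
    composition with the soft maximum. *)
Lemma softmax_weightE j u :
  softmax_weight j u = expR (beta * (u j - softmax u)).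
Proof.
rewrite /softmax_weight -!lock mulrBr expRD expRN; congr (_ / _).
by rewrite /softmax -!lock mulrC divfK ?gt_eqF// lnK// posrE sum_exp_gt0.
Qed.

Lemma coord_measurable_softmax_weight j : coord_measurable (softmax_weight j).
Proof.
move=> d T X mX; under eq_fun do rewrite softmax_weightE.
apply: measurableT_comp => //; apply: measurable_funM => //.
by apply: measurable_funB => //; exact: coord_measurable_softmax.
Qed.

Lemma coord_continuous_sum_exp : coordwise_continuous sum_exp.
Proof.
move=> T X cX; apply: continuous_big => //; first exact: add_continuous.
move=> k _ x.
apply: (continuous_comp (f := fun x => beta * X k x)); last exact: continuous_expR.
by apply: cvgM; [exact: cvg_cst|exact: cX].
Qed.

Lemma coord_continuous_softmax : coordwise_continuous softmax.
Proof.
move=> T X cX x; under eq_fun do rewrite /softmax -lock.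
apply: cvgM; last exact: cvg_cst.
apply: (continuous_comp (f := fun x => sum_exp (X ^~ x))).
  exact: coord_continuous_sum_exp.
by apply: continuous_ln; exact: sum_exp_gt0.
Qed.

Lemma coord_continuous_softmax_weight j : coordwise_continuous (softmax_weight j).
Proof.
move=> T X cX x; under eq_fun do rewrite softmax_weightE.
apply: (continuous_comp (f := fun x => beta * (X j x - softmax (X ^~ x))));
  last exact: continuous_expR.
apply: cvgM; first exact: cvg_cst.
by apply: cvgB; [exact: cX|exact: coord_continuous_softmax].
Qed.

End softmax.

Section test_function.
Variables (R : realType) (p : nat) (beta delta : R).
Hypotheses (p_gt0 : (0 < p)%N) (beta_gt0 : 0 < beta) (delta_gt0 : 0 < delta).
Implicit Types u : 'I_p -> R.

Local Notation F := (@softmax R p beta).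
Local Notation w := (@softmax_weight R p beta).

Definition test_fun u := spline0 (F u / delta).
Definition test_grad j u := spline1 (F u / delta) / delta * w j u.
Definition test_hess j k u :=
  spline2 (F u / delta) / delta ^+ 2 * (w j u * w k u) +
  spline1 (F u / delta) / delta * (beta * w j u * ((j == k)%:R - w k u)).

Definition mean_bump u := \sum_j w j u * cauchy_bump (u j / delta).

Lemma has_grad_test_fun : has_grad test_fun test_grad.
Proof.
have H := has_grad_comp (fun u => is_derive_spline0 (delta^-1 * F u))
  (has_gradZ delta^-1 (has_grad_softmax p_gt0 beta_gt0)).
rewrite (_ : test_fun = fun u => spline0 (delta^-1 * F u)); last first.
  by apply/funext => u; rewrite /test_fun mulrC.
by apply: eq_has_grad H => k u; rewrite /test_grad mulrA [F u / _]mulrC.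
Qed.

Lemma has_grad_test_grad j : has_grad (test_grad j) (test_hess j).
Proof.
have H1 := has_gradZ delta^-1 (has_grad_comp
  (fun u => is_derive_spline1 (delta^-1 * F u))
  (has_gradZ delta^-1 (has_grad_softmax p_gt0 beta_gt0))).
have H := has_gradM H1 (has_grad_softmax_weight beta p_gt0 j).
rewrite (_ : test_grad j = fun u => delta^-1 * spline1 (delta^-1 * F u) * w j u).
  apply: eq_has_grad H => k u; rewrite /test_hess [F u / _]mulrC.
  by field; rewrite gt_eqF.
by apply/funext => u; rewrite /test_grad mulrC [F u / _]mulrC; ring.
Qed.

Lemma test_fun_bounds u : 0 <= test_fun u <= 1.
Proof. exact: spline0_bounds. Qed.

Lemma test_fun_eq1 u : F u <= 0 -> test_fun u = 1.
Proof.
by move=> F0; apply: spline0_eq1; rewrite pmulr_lle0 ?invr_gt0.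
Qed.

Lemma test_fun_eq0 u : 3 * delta <= F u -> test_fun u = 0.
Proof. by move=> F0; apply: spline0_eq0; rewrite ler_pdivlMr. Qed.

Lemma normr_test_grad j u : `|test_grad j u| <= 10 / delta.
Proof.
rewrite normrM [`|w _ _|]ger0_norm ?softmax_weight_ge0//.
rewrite -[leRHS]mulr1 ler_pM// ?softmax_weight_le1 ?softmax_weight_ge0//.
rewrite normrM normfV (gtr0_norm delta_gt0) ler_pM2r ?invr_gt0//.
rewrite (le_trans (spline1_le _))// -[leRHS]mulr1 ler_pM2l// cauchy_bump_le1//.
Qed.

(** The weights sum to 1, so that summing p^2 entries costs no power of p. The factor 2 bounds the
    sum over k of [|(j == k) - w_k|]; the 10 comes from the spline bounds, which also supply the
    bump at the soft maximum. *)
Lemma sum_normr_test_hess_le u : \sum_j \sum_k `|test_hess j k u| <=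
  10 * (delta^-1 ^+ 2 + 2 * beta / delta) * cauchy_bump (F u / delta).
Proof.
set a := cauchy_bump _.
have H j k : `|test_hess j k u| <=
    10 * a / delta ^+ 2 * (w j u * w k u) +
    10 * a / delta * (beta * (w j u * ((j == k)%:R + w k u))).
  apply: le_trans (ler_normD _ _) _; apply: lerD.
    have ww : 0 <= w j u * w k u.
      by apply: mulr_ge0; exact: softmax_weight_ge0.
    rewrite normrM [`|w _ _ * _|]ger0_norm//; apply: ler_wpM2r => //.
    rewrite normrM normfV [`|_ ^+ 2|]ger0_norm ?exprn_ge0 ?(ltW delta_gt0)//.
    by rewrite ler_pM2r ?invr_gt0 ?exprn_gt0// spline2_le.
  rewrite normrM ler_pM//.
    by rewrite normrM normfV (gtr0_norm delta_gt0) ler_pM2r ?invr_gt0 ?spline1_le.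
  rewrite -!mulrA.
  rewrite !normrM (gtr0_norm beta_gt0) [`|w _ _|]ger0_norm ?softmax_weight_ge0//.
  rewrite ler_pM2l// ler_wpM2l ?softmax_weight_ge0//.
  rewrite (le_trans (ler_normB _ _))// !ger0_norm ?softmax_weight_ge0//.
apply: le_trans (ler_sum _ (fun j _ => ler_sum _ (fun k _ => H j k))) _.
have Hj j : \sum_k (10 * a / delta ^+ 2 * (w j u * w k u) +
    10 * a / delta * (beta * (w j u * ((j == k)%:R + w k u)))) =
    (10 * a / delta ^+ 2 + 10 * a / delta * beta * 2) * w j u.
  rewrite big_split/= -!big_distrr/= big_split/= sum_softmax_weight//.
  rewrite (bigD1 j)//= eqxx big1 ?addr0; last first.
    by move=> k kj; rewrite eq_sym (negbTE kj).
  by rewrite mulr1n; ring.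
rewrite (eq_bigr _ (fun j _ => Hj j)) -big_distrr/= sum_softmax_weight//.
by rewrite mulr1 le_eqVlt; apply/orP; left; apply/eqP; field; rewrite gt_eqF.
Qed.

(* By the entropy bound, the mean of [(F u - u j) / delta] under the softmax
   weights is at most 1. *)
Lemma cauchy_bump_softmax_le u : beta * delta = ln p%:R ->
  cauchy_bump (F u / delta) <= 4 * mean_bump u.
Proof.
move=> bd; set a := F u / delta.
(* A minorant affine in the displacement d = x - y can be averaged when only the mean of d is known.
   For a mean of at most 1 it leaves 1/2 - 1/4, whence the factor 4. *)
have bump_sub (x y : R) : 0 <= x - y ->
    cauchy_bump x * (2^-1 - (x - y) / 4) <= cauchy_bump y.
  move=> xy; rewrite /cauchy_bump -!lock mulrC ler_pdivrMr; last nra.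
  rewrite ler_pdivlMl; last nra.
  have -> : x = y + (x - y) by ring.
  move: (x - y) xy => d d0.
  rewrite (_ : y + d - y = d); last by ring.
  have [q0|q0] := leP (2^-1 - d / 4) 0.
    by have := sqr_ge0 y; have := sqr_ge0 (y + d); nra.
  (* The right side minus the left is d (d - 1)^2 / 4. *)
  have h1 : (2^-1 - d / 4) * (1 + d ^+ 2) <= 2^-1.
    by have := mulr_ge0 d0 (sqr_ge0 (d - 1)); lra.
  (* Peetre's inequality, based on 2 (y + d)^2 + 2 d^2 - y^2 = (y + 2 d)^2. *)
  have h2 : 1 + y ^+ 2 <= 2 * (1 + (y + d) ^+ 2) * (1 + d ^+ 2).
    have := sqr_ge0 (y + 2 * d); have := sqr_ge0 (d * (y + d)).
    by have := sqr_ge0 d; have := sqr_ge0 (y + d); lra.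
  apply: (@le_trans _ _ (2 * (1 + (y + d) ^+ 2) * (1 + d ^+ 2) * (2^-1 - d / 4))).
    by rewrite ler_pM2r.
  have : 0 <= 1 + (y + d) ^+ 2 by have := sqr_ge0 (y + d); lra.
  nra.
have E : \sum_j w j u * ((F u - u j) / delta) <= 1.
  under eq_bigr do rewrite mulrA.
  rewrite -big_distrl/= ler_pdivrMr// mul1r.
  apply: le_trans (softmax_weight_entropy_le p_gt0 beta_gt0 u) _.
  by rewrite -bd mulrC mulKf ?gt_eqF.
have a0 := cauchy_bump_gt0 a.
suff : cauchy_bump a * (2^-1 - 1 / 4) <= mean_bump u by lra.
apply: (@le_trans _ _ (\sum_j w j u *
    (cauchy_bump a * (2^-1 - (a - u j / delta) / 4)))); last first.
  apply: ler_sum => j _; rewrite ler_wpM2l ?softmax_weight_ge0// bump_sub//.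
  by rewrite -mulrBl divr_ge0 ?subr_ge0 ?le_softmax// ltW.
have -> : \sum_j w j u * (cauchy_bump a * (2^-1 - (a - u j / delta) / 4)) =
    cauchy_bump a * (2^-1 - (\sum_j w j u * ((F u - u j) / delta)) / 4).
  rewrite (eq_bigr (fun j => cauchy_bump a / 2 * w j u -
    cauchy_bump a / 4 * (w j u * ((F u - u j) / delta)))).
    by rewrite sumrB -!big_distrr/= sum_softmax_weight//; ring.
  by move=> j _; rewrite /a mulrBl; ring.
by rewrite ler_pM2l//; lra.
Qed.

Lemma mean_bump_bounds u : 0 <= mean_bump u <= 1.
Proof.
apply/andP; split.
  apply: sumr_ge0 => j _.
  by rewrite mulr_ge0 ?softmax_weight_ge0// ltW// cauchy_bump_gt0.
rewrite -(sum_softmax_weight beta p_gt0 u); apply: ler_sum => j _.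
by rewrite ler_piMr ?softmax_weight_ge0// cauchy_bump_le1.
Qed.

Lemma coord_measurable_test_fun : coord_measurable test_fun.
Proof.
move=> d T X mX; apply: measurableT_comp.
  by apply: continuous_measurable_fun; exact: continuous_spline0.
by apply: measurable_funM => //; exact: coord_measurable_softmax.
Qed.

Lemma coord_measurable_test_grad j : coord_measurable (test_grad j).
Proof.
move=> d T X mX; apply: measurable_funM.
  apply: measurable_funM => //; apply: measurableT_comp.
    by apply: continuous_measurable_fun; exact: continuous_spline1.
  by apply: measurable_funM => //; exact: coord_measurable_softmax.
exact: coord_measurable_softmax_weight.
Qed.

Lemma coord_measurable_test_hess j k : coord_measurable (test_hess j k).
Proof.
move=> d T X mX.
have mF : measurable_fun [set: T] (fun t => softmax beta (X^~ t) / delta).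
  by apply: measurable_funM => //; exact: coord_measurable_softmax.
have mw i : measurable_fun [set: T] (fun t => w i (X^~ t)).
  exact: coord_measurable_softmax_weight.
apply: measurable_funD; apply: measurable_funM.
- apply: measurable_funM => //; apply: measurableT_comp => //.
  by apply: continuous_measurable_fun; exact: continuous_spline2.
- exact: measurable_funM.
- apply: measurable_funM => //; apply: measurableT_comp => //.
  by apply: continuous_measurable_fun; exact: continuous_spline1.
- apply: measurable_funM; first exact: measurable_funM.
  exact: measurable_funB.
Qed.

Lemma coord_measurable_mean_bump : coord_measurable mean_bump.
Proof.
move=> d T X mX; apply: measurable_sum => j; apply: measurable_funM.
  exact: coord_measurable_softmax_weight.
apply: measurableT_comp; last exact: measurable_funM.
by apply: continuous_measurable_fun; exact: continuous_cauchy_bump.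
Qed.

Lemma coord_continuous_test_fun : coordwise_continuous test_fun.
Proof.
move=> T X cX x.
apply: (continuous_comp (f := fun x => softmax beta (X ^~ x) / delta));
  last exact: continuous_spline0.
by apply: cvgM; [exact: coord_continuous_softmax|exact: cvg_cst].
Qed.

Lemma coord_continuous_test_grad j : coordwise_continuous (test_grad j).
Proof.
move=> T X cX x; apply: cvgM; last exact: coord_continuous_softmax_weight.
apply: cvgM; last exact: cvg_cst.
apply: (continuous_comp (f := fun x => softmax beta (X ^~ x) / delta));
  last exact: continuous_spline1.
by apply: cvgM; [exact: coord_continuous_softmax|exact: cvg_cst].
Qed.

Lemma coord_continuous_test_hess j k : coordwise_continuous (test_hess j k).
Proof.
move=> T X cX x.
have cF : {for x, continuous (fun x => softmax beta (X ^~ x) / delta)}.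
  by apply: cvgM; [exact: coord_continuous_softmax|exact: cvg_cst].
have cw i : {for x, continuous (fun x => w i (X ^~ x))}.
  exact: coord_continuous_softmax_weight.
apply: cvgD; apply: cvgM.
- apply: cvgM; last exact: cvg_cst.
  by apply: (continuous_comp cF); exact: continuous_spline2.
- by apply: cvgM; exact: cw.
- apply: cvgM; last exact: cvg_cst.
  by apply: (continuous_comp cF); exact: continuous_spline1.
- apply: cvgM; first by apply: cvgM; [exact: cvg_cst|exact: cw].
  by apply: cvgB; [exact: cvg_cst|exact: cw].
Qed.

Lemma test_hess_bounded j k u : `|test_hess j k u| <=
  10 * (delta^-1 ^+ 2 + 2 * beta / delta).
Proof.
apply: (@le_trans _ _ (\sum_j \sum_k `|test_hess j k u|)).
  rewrite (bigD1 j)//= (bigD1 k)//= -addrA lerDl addr_ge0 ?sumr_ge0// => i _.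
  by rewrite sumr_ge0.
apply: (le_trans (sum_normr_test_hess_le u)).
rewrite -[leRHS]mulr1 ler_wpM2l ?cauchy_bump_le1// mulr_ge0//.
by rewrite addr_ge0 ?sqr_ge0// divr_ge0 ?(ltW delta_gt0)// mulr_ge0// ltW.
Qed.


End test_function.

(** * Gaussian integration by parts *)

Section normal_integration.
Variable R : realType.
Local Notation lambda := (@lebesgue_measure R).

Section change_of_measure.
Variables m s : R.
Local Notation gamma := (normal_prob m s).
Local Notation phi := (normal_pdf m s).

(** The Radon-Nikodym derivative of the normal law agrees almost everywhere with its density, both
    having the same integral over every measurable set. *)
Lemma ge0_integral_normal_prob (f : R -> \bar R) :
  (forall x, (0 <= f x)%E) -> measurable_fun [set: R] f ->
  (\int[gamma]_x f x = \int[lambda]_x (f x * (phi x)%:E))%E.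
Proof.
move=> f0 mf; have dom := @normal_prob_dominates R m s.
rewrite -(Radon_Nikodym_SigmaFinite.change_of_variables dom)//.
apply: ae_eq_integral => //.
- apply: emeasurable_funM => //; apply: measurable_int.
  exact: Radon_Nikodym_SigmaFinite.f_integrable.
- apply: emeasurable_funM => //; apply/measurable_EFinP.
  exact: measurable_normal_pdf.
have : ae_eq lambda setT
    (Radon_Nikodym_SigmaFinite.f gamma lambda) (fun x => (phi x)%:E).
  apply: integral_ae_eq => //.
  - exact: Radon_Nikodym_SigmaFinite.f_integrable.
  - by apply/measurable_EFinP; exact: measurable_normal_pdf.
  - by move=> E _ mE; rewrite -Radon_Nikodym_SigmaFinite.f_integral.
by apply: filterS => x /= fphi xT; rewrite fphi.
Qed.

Lemma integral_normal_prob (f : R -> R) : measurable_fun [set: R] f ->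
  (\int[gamma]_x (f x)%:E = \int[lambda]_x (f x * phi x)%:E)%E.
Proof.
move=> mf; rewrite integralE [RHS]integralE.
have mEf : measurable_fun [set: R] (EFin \o f) by exact/measurable_EFinP.
rewrite !ge0_integral_normal_prob//; last 2 first.
- exact: measurable_funeneg.
- exact: measurable_funepos.
congr (_ - _)%E; apply: eq_integral => x _.
  by rewrite !funeposE EFinM maxe_pMl ?mul0e// lee_fin normal_pdf_ge0.
by rewrite !funenegE EFinM -mulNe maxe_pMl ?mul0e// lee_fin normal_pdf_ge0.
Qed.

Lemma integrable_normal_prob (f : R -> R) : measurable_fun [set: R] f ->
  gamma.-integrable [set: R] (EFin \o f) ->
  lambda.-integrable [set: R] (fun x => (f x * phi x)%:E).
Proof.
move=> mf /integrableP[_ fi]; apply/integrableP; split.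
  by apply/measurable_EFinP; apply: measurable_funM => //; exact: measurable_normal_pdf.
rewrite ge0_integral_normal_prob// in fi; last first.
  by apply/measurable_EFinP; exact: measurableT_comp.
under eq_integral do rewrite abse_EFin normrM (ger0_norm (normal_pdf_ge0 _ _ _)) EFinM.
by [].
Qed.

End change_of_measure.

Local Notation gamma := (normal_prob (0 : R) 1).
Local Notation phi := (normal_pdf (0 : R) 1).

(** Completing the square: an exponential tilt of the standard normal density is, up to a constant,
    its translate by t. The moment generating function follows at once. *)
Lemma normal_pdf_translate (t x : R) :
  expR (t * x) * phi x = expR (t ^+ 2 / 2) * normal_pdf t 1 x.
Proof.
rewrite !normal_pdfE ?oner_eq0// !mulrA [_ * normal_peak 1]mulrC.
rewrite [X in _ = X * _]mulrC -!mulrA /normal_fun -!expRD; congr (_ * expR _).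
by field.
Qed.

Lemma normal_prob_mgf (t : R) :
  (\int[gamma]_x (expR (t * x))%:E = (expR (t ^+ 2 / 2))%:E)%E.
Proof.
rewrite integral_normal_prob; last first.
  by apply: measurableT_comp => //; exact: measurable_funM.
under eq_integral do rewrite normal_pdf_translate EFinM.
rewrite integralZl//; last exact: integrable_normal_pdf.
by rewrite integral_normal_pdf mule1.
Qed.

Lemma integrable_expR_normal (t : R) :
  gamma.-integrable [set: R] (fun x => (expR (t * x))%:E).
Proof.
apply/integrableP; split.
  by apply/measurable_EFinP/measurableT_comp => //; exact: measurable_funM.
under eq_integral do rewrite gee0_abs ?lee_fin ?expR_ge0//.
by rewrite normal_prob_mgf ltry.
Qed.

(** Domination by exponentials: 1 + x^2 <= 2 exp |x| <= 2 (exp x + exp (-x)), both integrable by the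
    moment generating function at 1 and -1. *)
Lemma integrable_normal_sqr :
  gamma.-integrable [set: R] (fun x => (1 + x ^+ 2)%:E).
Proof.
have I1 := integrable_expR_normal 1; have I2 := integrable_expR_normal (-1).
apply: (le_integrable measurableT _ _ (integrableZl measurableT 2 (integrableD measurableT I1 I2))).
  by apply/measurable_EFinP; apply: measurable_funD.
move=> x _; rewrite mul1r mulN1r -[2%E]/(2%:E) -EFinD -EFinM lee_fin.
have H (y : R) : 0 <= y -> 1 + y ^+ 2 <= 2 * expR y.
  by move=> y0; have := expR_ge1Dxn 1 y0; rewrite (_ : 2`! = 2)%N//; lra.
have x1 : 0 <= 1 + x ^+ 2 by have := sqr_ge0 x; lra.
have := expR_ge0 x; have := expR_ge0 (- x) => e1 e2.
rewrite (ger0_norm x1) [leRHS]ger0_norm; last lra.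
have [x0|x0] := leP 0 x; first by have := H x x0; lra.
by have := H (- x); rewrite oppr_ge0 (ltW x0) sqrrN => /(_ isT); lra.
Qed.

Lemma is_derive_normal_pdf (x : R) : is_derive x 1 phi (- x * phi x).
Proof.
rewrite normal_pdfE ?oner_eq0//= /normal_fun.
have H := is_deriveZ_pt (normal_peak 1) (is_derive_comp_pt (is_derive_expR _)
  (is_deriveZ_pt (- 2^-1) (is_deriveM_pt (is_derive_id x 1) (is_derive_id x 1)))).
rewrite (_ : (fun _ => _) = fun t => normal_peak 1 * expR (- 2^-1 * (t * t))).
  apply: is_derive_eq H _.
  rewrite (_ : - (x - 0) ^+ 2 / (1 ^+ 2 *+ 2) = - 2^-1 * (x * x)); last by field.
  by field.
by apply/funext => t; congr (_ * expR _); field.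
Qed.

(** Makes the boundary terms of the integration by parts vanish for h of linear growth. It holds
    since exp(x^2 / 2) >= 1 + x^2 / 2 >= (1 + |x|)^2 / 4 and the peak of the density is at most
    1. *)
Lemma normal_pdf_decay (x : R) : (1 + `|x|) * phi x <= 4 / (1 + `|x|).
Proof.
rewrite ler_pdivlMr ?ltr_pwDl// mulrAC -expr2.
rewrite normal_pdfE ?oner_eq0//= /normal_fun subr0 expr1n.
have peak : normal_peak (1 : R) <= 1.
  rewrite /normal_peak invf_le1.
    rewrite -[leLHS]sqrtr1 ler_wsqrtr// expr1n mul1r.
    by have := @pi_ge2 R; lra.
  by rewrite sqrtr_gt0 expr1n mul1r; have := @pi_ge2 R; lra.
have peak0 := normal_peak_ge0 (1 : R).
rewrite mulrCA -[leRHS]mul1r ler_pM//.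
have -> : - x ^+ 2 / (1 *+ 2) = - (`|x| ^+ 2 / 2).
  by rewrite real_normK ?num_real// mulNr.
rewrite expRN ler_pdivrMr ?expR_gt0//.
have := expR_ge1Dx (`|x| ^+ 2 / 2).
have := sqr_ge0 (`|x| - 1); lra.
Qed.

Lemma integrable_normal_quadratic (f : R -> R) (C : R) :
  measurable_fun [set: R] f -> (forall x, `|f x| <= C * (1 + x ^+ 2)) ->
  gamma.-integrable [set: R] (EFin \o f).
Proof.
move=> mf fC.
apply: (le_integrable measurableT _ _ (integrableZl measurableT C integrable_normal_sqr)).
  exact/measurable_EFinP.
by move=> x _; rewrite /= lee_fin (le_trans (fC x))// ler_norm.
Qed.

(** The fundamental theorem of calculus on growing intervals, with dominated convergence for the
    integrals and decay of h phi at the endpoints. Linear growth is allowed so that h can be a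
    coordinate. *)
Lemma normal_integration_by_parts (h h' : R -> R) (C : R) :
  (forall x : R, is_derive x 1 h (h' x)) -> continuous h' ->
  (forall x, `|h x| <= C * (1 + `|x|)) -> (forall x, `|h' x| <= C) ->
  (\int[gamma]_x (x * h x)%:E = \int[gamma]_x (h' x)%:E)%E.
Proof.
move=> dh ch' hC h'C.
have ch : continuous h.
  by move=> x; apply/differentiable_continuous/derivable1_diffP; case: (dh x).
have C0 : 0 <= C by apply: le_trans (h'C 0).
have mh := continuous_measurable_fun ch.
have mh' := continuous_measurable_fun ch'.
have mxh : measurable_fun [set: R] (fun x => x * h x) by exact: measurable_funM.
have i1 : gamma.-integrable [set: R] (EFin \o h').
  apply: (@integrable_normal_quadratic _ C) => // x.
  by rewrite (le_trans (h'C x))// ler_peMr// lerDl sqr_ge0.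
have i2 : gamma.-integrable [set: R] (EFin \o (fun x => x * h x)).
  apply: (@integrable_normal_quadratic _ (2 * C)) => // x.
  rewrite normrM (le_trans (ler_wpM2l (normr_ge0 x) (hC x)))//.
  rewrite (mulrC 2 C) -(mulrA C) mulrCA -[x ^+ 2]real_normK ?num_real//.
  apply: ler_wpM2l => //.
  by have := sqr_ge0 (`|x| - 1); have := sqr_ge0 `|x|; lra.
rewrite -[LHS]fineK ?integrable_fin_num// -[RHS]fineK ?integrable_fin_num//.
congr EFin; apply/eqP; rewrite -subr_eq0 -[_ - _]/(_ - _) -RintegralB//.
apply/eqP.
(* K phi is the derivative of - h phi. *)
pose K x := x * h x - h' x.
have mK : measurable_fun [set: R] K by exact: measurable_funB.
have iK : gamma.-integrable [set: R] (EFin \o K).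
  by have := integrableB measurableT i2 i1; apply: eq_integrable.
have iKl := integrable_normal_prob mK iK.
rewrite /Rintegral integral_normal_prob//.
suff -> : (\int[lambda]_x (K x * phi x)%:E = 0)%E by [].
have cphi : continuous phi by apply: continuous_normal_pdf; rewrite oner_eq0.
(* With endpoints n + 1 the interval is never degenerate, and the boundary terms are compared with
   [harmonic n] = 1 / (n + 1). *)
pose fn (n : nat) : R -> \bar R :=
  (fun x => (K x * phi x)%:E) \_ `[- n.+1%:R, n.+1%:R].
have mKphi : measurable_fun [set: R] (fun x => (K x * phi x)%:E).
  exact: measurable_int iKl.
have [] := @dominated_convergence _ _ _ lambda _ measurableT fn
  (fun x => (K x * phi x)%:E) (fun x => `|(K x * phi x)%:E|%E).
- move=> n; apply: (measurable_restrictT _ _).1; first exact: measurable_itv.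
  exact: measurable_funTS mKphi.
- exact: mKphi.
- apply: aeW => x _; apply: cvg_near_cst; near=> n.
  rewrite /fn patchE ifT// inE/= in_itv/= -ler_norml.
  apply: (@le_trans _ _ n%:R); last by rewrite ler_nat.
  near: n; exact: nbhs_infty_ger.
- exact: integrable_abse.
- apply: aeW => x n _; rewrite /fn patchE; case: ifPn => // _.
  by rewrite abse0.
move=> _ _ cv.
have cv0 : (\int[lambda]_x fn n x)%E @[n --> \oo] --> 0%E.
  have E n : (\int[lambda]_x fn n x =
      (- (h n.+1%:R * phi n.+1%:R) + h (- n.+1%:R) * phi (- n.+1%:R))%:E)%E.
    rewrite -integral_mkcond.
    have dF (x : R) : is_derive x 1 (fun x => - (h x * phi x)) (K x * phi x).
      have := is_deriveZ_pt (-1) (is_deriveM_pt (dh x) (is_derive_normal_pdf x)).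
      under eq_fun do rewrite mulN1r.
      by move=> H; apply: is_derive_eq H _; rewrite /K; ring.
    have cF : continuous (fun x => - (h x * phi x)).
      by move=> x; apply/differentiable_continuous/derivable1_diffP; case: (dF x).
    rewrite (@continuous_FTC2 _ (fun x => K x * phi x) (fun x => - (h x * phi x))).
    - by rewrite -EFinB opprK.
    - by rewrite gtrN.
    - apply: continuous_subspaceT => x; apply: cvgM; last exact: cphi.
      by apply: cvgB; [apply: cvgM; [exact: cvg_id|exact: ch]|exact: ch'].
    - split; first by move=> x _; case: (dF x).
      + exact/cvg_at_right_filter/cF.
      + exact/cvg_at_left_filter/cF.
    - by move=> x _; rewrite derive1E; apply: derive_val.
  under eq_fun do rewrite E.
  have bnd n (y : R) : `|y| = n.+1%:R -> `|h y * phi y| <= 4 * C * harmonic n.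
    move=> yn; rewrite normrM (ger0_norm (normal_pdf_ge0 _ _ _)).
    apply: le_trans (ler_wpM2r (normal_pdf_ge0 _ _ _) (hC y)) _.
    rewrite [4 * C]mulrC -!mulrA ler_wpM2l//.
    apply: le_trans (normal_pdf_decay y) _; rewrite ler_pM2l//.
    by rewrite yn /harmonic lef_pV2 ?posrE ?ltr0n// ?ltr_pwDl// lerDr.
  apply: cvg_EFin; first exact: nearW.
  apply: norm_cvg0; apply: (@squeeze_cvgr _ _ _ _ (cst 0)
     (fun n => 8 * C * harmonic n)).
  - apply: nearW => n; rewrite normr_ge0 /= (le_trans (ler_normD _ _))// normrN.
    have -> : 8 * C * harmonic n = 4 * C * harmonic n + 4 * C * harmonic n by ring.
    by apply: lerD; apply: bnd; rewrite ?normrN ger0_norm.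
  - exact: cvg_cst.
  - rewrite -[X in _ --> X](mulr0 (8 * C)); apply: cvgM; first exact: cvg_cst.
    exact: cvg_harmonic.
exact: cvg_unique cv cv0.
Unshelve. all: by end_near. Qed.
End normal_integration.

(** * Transfer of integrals between equal laws *)

Section same_law.
Context d1 d2 d (T1 : measurableType d1) (T2 : measurableType d2)
  (Y : measurableType d) (R : realType)
  (P1 : {measure set T1 -> \bar R}) (P2 : {measure set T2 -> \bar R}).
Variables (f1 : T1 -> Y) (f2 : T2 -> Y).
Hypotheses (mf1 : measurable_fun [set: T1] f1) (mf2 : measurable_fun [set: T2] f2).
Hypothesis same_law : forall A, measurable A -> P1 (f1 @^-1` A) = P2 (f2 @^-1` A).

Let X1 : {mfun T1 >-> Y} := HB.pack f1 (isMeasurableFun.Build _ _ _ _ _ mf1).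
Let X2 : {mfun T2 >-> Y} := HB.pack f2 (isMeasurableFun.Build _ _ _ _ _ mf2).

Lemma ge0_integral_same_law (g : Y -> \bar R) :
  measurable_fun [set: Y] g -> (forall y, (0 <= g y)%E) ->
  (\int[P1]_x g (f1 x) = \int[P2]_x g (f2 x))%E.
Proof.
move=> mg g0.
transitivity (\int[pushforward P1 X1]_y g y)%E.
  by rewrite ge0_integral_pushforward.
transitivity (\int[pushforward P2 X2]_y g y)%E.
  by apply: eq_measure_integral => A mA _; exact: same_law.
by rewrite ge0_integral_pushforward.
Qed.

Lemma integrable_same_law (g : Y -> \bar R) : measurable_fun [set: Y] g ->
  P1.-integrable [set: T1] (g \o f1) -> P2.-integrable [set: T2] (g \o f2).
Proof.
move=> mg /integrableP[_ gi]; apply/integrableP; split.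
  exact: measurableT_comp.
rewrite -(@ge0_integral_same_law (fun y => `|g y|%E))//.
exact: measurableT_comp.
Qed.

Lemma integral_same_law (g : Y -> \bar R) : measurable_fun [set: Y] g ->
  (\int[P1]_x g (f1 x) = \int[P2]_x g (f2 x))%E.
Proof.
move=> mg; rewrite integralE [RHS]integralE; congr (_ - _)%E.
  rewrite (eq_integral (fun x => g^\+%E (f1 x))) => [|x _]; last by rewrite !funeposE.
  rewrite [RHS](eq_integral (fun x => g^\+%E (f2 x))) => [|x _]; last by rewrite !funeposE.
  by apply: ge0_integral_same_law => //; exact: measurable_funepos.
rewrite (eq_integral (fun x => g^\-%E (f1 x))) => [|x _]; last by rewrite !funenegE.
rewrite [RHS](eq_integral (fun x => g^\-%E (f2 x))) => [|x _]; last by rewrite !funenegE.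
by apply: ge0_integral_same_law => //; exact: measurable_funeneg.
Qed.

End same_law.

(** * Product sigma-algebra and standard normal families *)

Section boxes.
Variables (R : realType) (m : nat).

Definition boxes : set (set ('I_m -> R)) := [set A | exists B : 'I_m -> set R,
  (forall i, measurable (B i)) /\ A = [set x | forall i, B i (x i)]].

(** The product sigma-algebra, presented by a generating pi-system: a law on it is determined by its
    values on boxes, which is exactly what [std_gaussian] prescribes. *)
Definition box_space := g_sigma_algebraType boxes.

Lemma boxes_setI_closed : setI_closed boxes.
Proof.
move=> _ _ [B [mB ->]] [C [mC ->]]; exists (fun i => B i `&` C i); split.
  by move=> i; exact: measurableI.
apply/seteqP; split => x /=; first by case=> HB HC i; split.
by move=> H; split=> i; case: (H i).
Qed.

Lemma boxes_setT : boxes setT.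
Proof.
by exists (fun=> setT); split=> //; apply/seteqP; split.
Qed.

Lemma measurable_fun_box_space d (T : measurableType d) (X : 'I_m -> T -> R) :
  (forall i, measurable_fun [set: T] (X i)) ->
  measurable_fun [set: T] (fun w => X ^~ w : box_space).
Proof.
move=> mX; apply: (@measurability _ _ T box_space _ _ boxes) => //.
move=> _ [_ [B [mB ->] <-]].
rewrite setTI (_ : _ @^-1` _ = \bigcap_(i in [set: 'I_m]) (X i @^-1` B i)).
  apply: fin_bigcap_measurable => // i _.
  by rewrite -[X in measurable X]setTI; exact: mX.
by apply/seteqP; split => [w /= H i _|w H i]; [exact: H|exact: H].
Qed.

Lemma measurable_box_coord i :
  measurable_fun [set: box_space] (fun x : box_space => x i).
Proof.
move=> _ B mB; rewrite setTI; apply: sub_sigma_algebra.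
exists (fun k => if k == i then B else setT); split.
  by move=> k; case: ifP.
apply/seteqP; split => x /=.
  by move=> Bx k; case: eqP => [->|].
by move=> /(_ i); rewrite eqxx.
Qed.

Lemma coord_measurable_box_space (h : ('I_m -> R) -> R) : coord_measurable h ->
  measurable_fun [set: box_space] (h : box_space -> R).
Proof. by move=> mh; apply: mh => i; exact: measurable_box_coord. Qed.

End boxes.

Definition update (R : realType) m (x : 'I_m -> R) (i : 'I_m) (r : R) :
  'I_m -> R := fun k => if k == i then r else x k.

(** Independence and normality in a single condition on boxes, stated for scalar coordinates, so
    that no topology on row vectors intervenes. *)
Definition std_normal_family (R : realType) d (T : measurableType d)
    (P : probability T R) m (X : 'I_m -> T -> R) : Prop :=
  (forall i, measurable_fun [set: T] (X i)) /\
  forall B : 'I_m -> set R, (forall i, measurable (B i)) ->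
    P [set w | forall i, B i (X i w)] = (\prod_(i < m) normal_prob 0 1 (B i))%E.

Section std_normal_family.
Context (R : realType) d (T : measurableType d) (P : probability T R).
Variables (m : nat) (X : 'I_m -> T -> R).
Hypothesis HX : std_normal_family P X.
Local Notation gamma := (normal_prob (0 : R) 1).

Let mX := HX.1.

Lemma measurable_update i k :
  measurable_fun [set: T * R] (fun z => update (X ^~ z.1) i z.2 k).
Proof.
rewrite /update; case: eqP => _; first exact: measurable_snd.
by apply: (measurableT_comp (f := X k)); [exact: mX|exact: measurable_fst].
Qed.

(** Replacing the i-th coordinate by an independent standard normal preserves the law. On a box, the
    i-th side is freed under P and its probability is restored by the factor gamma; uniqueness on
    the pi-system does the rest. This isolates one coordinate for Fubini without building an m-fold
    product measure. *)
Lemma resample_law i (A : set (box_space R m)) : measurable A ->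
  P ((fun w => X ^~ w : box_space R m) @^-1` A) =
  (P \x gamma)%E ((fun z => update (X ^~ z.1) i z.2 : box_space R m) @^-1` A).
Proof.
have mf1 := measurable_fun_box_space mX.
have mf2 := measurable_fun_box_space (measurable_update i).
pose X1 : {mfun T >-> box_space R m} :=
  HB.pack (fun w => X ^~ w : box_space R m) (isMeasurableFun.Build _ _ _ _ _ mf1).
pose X2 : {mfun (T * R)%type >-> box_space R m} :=
  HB.pack (fun z => update (X ^~ z.1) i z.2 : box_space R m)
    (isMeasurableFun.Build _ _ _ _ _ mf2).
move=> mA; apply: (@measure_unique _ R (box_space R m) (@boxes R m) (fun=> setT)
    _ _ _ _ (pushforward P X1) (pushforward (P \x gamma)%E X2)) => //.
- exact: boxes_setI_closed.
- move=> _; exact: boxes_setT.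
- by apply/seteqP; split => // x _; exists 0%N.
- move=> _ [B [mB ->]].
  pose C k := if k == i then setT else B k.
  have mC k : measurable (C k) by rewrite /C; case: ifP.
  have mXC : measurable [set w | forall k, C k (X k w)].
    rewrite (_ : mkset _ = \bigcap_(k in [set: 'I_m]) (X k @^-1` C k)).
      apply: fin_bigcap_measurable => // k _.
      by rewrite -[X in measurable X]setTI; exact: mX.
    by apply/seteqP; split => [w /= H k _|w H k]; [exact: H|exact: H].
  transitivity (P [set w | forall k, B k (X k w)]) => //.
  transitivity ((P \x gamma)%E ([set w | forall k, C k (X k w)] `*` B i)).
    rewrite product_measure1E//; last exact: mB.
    transitivity (\prod_(k < m) gamma (B k))%E; first exact: HX.2.
    transitivity ((\prod_(k < m) gamma (C k)) * gamma (B i))%E; last first.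
      by congr (_ * _)%E; apply/esym; exact: HX.2.
    rewrite (bigD1 i)//= [in RHS](bigD1 i)//=.
    rewrite {1}/C eqxx probability_setT mul1e muleC; congr (_ * _)%E.
    by apply: eq_bigr => k ki; rewrite /C (negbTE ki).
  congr ((P \x gamma)%E _); apply/seteqP; split => -[w r] /=.
    by move=> [H1 H2] k; have := H1 k; rewrite /C /update; case: eqP => // ->.
  move=> H; split; last by have := H i; rewrite /update eqxx.
  by move=> k; have := H k; rewrite /C /update; case: eqP.
- by move=> _; suff : (P setT < +oo)%E by []; rewrite probability_setT ltry.
Qed.

Lemma integrable_resample i (h : ('I_m -> R) -> R) : coord_measurable h ->
  P.-integrable [set: T] (fun w => (h (X ^~ w))%:E) ->
  (P \x gamma)%E.-integrable [set: T * R]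
    (fun z => (h (update (X ^~ z.1) i z.2))%:E).
Proof.
move=> mh; have mEh : measurable_fun [set: box_space R m] (EFin \o (h : box_space R m -> R)).
  by apply/measurable_EFinP; exact: coord_measurable_box_space.
have := (integrable_same_law (P1 := P) (P2 := (P \x gamma)%E) (measurable_fun_box_space mX)
  (measurable_fun_box_space (measurable_update i)) (@resample_law i) mEh).
apply.
Qed.

Lemma Rintegral_resample i (h : ('I_m -> R) -> R) : coord_measurable h ->
  \int[P]_w h (X ^~ w) = \int[(P \x gamma)%E]_z h (update (X ^~ z.1) i z.2).
Proof.
move=> mh; have mEh : measurable_fun [set: box_space R m] (EFin \o (h : box_space R m -> R)).
  by apply/measurable_EFinP; exact: coord_measurable_box_space.
congr fine.
exact: (integral_same_law (P1 := P) (P2 := (P \x gamma)%E) (measurable_fun_box_space mX)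
  (measurable_fun_box_space (measurable_update i)) (@resample_law i) mEh).
Qed.

Lemma ge0_integral_resample i (h : ('I_m -> R) -> R) : coord_measurable h ->
  (forall x, 0 <= h x) ->
  (\int[P]_w (h (X ^~ w))%:E =
   \int[P]_w \int[gamma]_r (h (update (X ^~ w) i r))%:E)%E.
Proof.
move=> mh h0; have mEh : measurable_fun [set: box_space R m] (EFin \o (h : box_space R m -> R)).
  by apply/measurable_EFinP; exact: coord_measurable_box_space.
rewrite (ge0_integral_same_law (P1 := P) (P2 := (P \x gamma)%E) (measurable_fun_box_space mX)
  (measurable_fun_box_space (measurable_update i)) (@resample_law i) mEh); last first.
  by move=> x; rewrite /= lee_fin.
rewrite fubini_tonelli1//; last by move=> x; rewrite /= lee_fin.
by apply/measurable_EFinP; apply: mh => k; exact: measurable_update.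
Qed.

Lemma coordinate_law i (A : set R) : measurable A -> P (X i @^-1` A) = gamma A.
Proof.
move=> mA; pose B k := if k == i then A else setT.
have -> : X i @^-1` A = [set w | forall k, B k (X k w)].
  apply/seteqP; split => w /=; first by move=> Aw k; rewrite /B; case: eqP => // ->.
  by move=> /(_ i); rewrite /B eqxx.
rewrite HX.2; last by move=> k; rewrite /B; case: ifP.
rewrite (bigD1 i)//= {1}/B eqxx big1 ?mule1// => k ki.
by rewrite /B (negbTE ki) probability_setT.
Qed.

Lemma integrable_coordinate i (f : R -> R) : measurable_fun [set: R] f ->
  gamma.-integrable [set: R] (EFin \o f) ->
  P.-integrable [set: T] (fun w => (f (X i w))%:E).
Proof.
move=> mf; have mEf : measurable_fun [set: R] (EFin \o f) by exact/measurable_EFinP.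
apply: (integrable_same_law (P1 := gamma) (P2 := P) (@measurable_id _ _ setT) (mX i) _ mEf).
by move=> A mA; apply/esym; exact: coordinate_law.
Qed.

Lemma integrable_coordinate1 i : P.-integrable [set: T] (fun w => (X i w)%:E).
Proof.
apply: (@integrable_coordinate i id) => //.
apply: (@integrable_normal_quadratic _ _ 1) => // x; rewrite mul1r.
by rewrite -[x ^+ 2]real_normK ?num_real//; have := sqr_ge0 (`|x| - 1); have := normr_ge0 x; nra.
Qed.

Lemma integrable_coordinate_sqr i :
  P.-integrable [set: T] (fun w => (X i w ^+ 2)%:E).
Proof.
apply: (@integrable_coordinate i (fun x => x ^+ 2)) => //.
apply: (@integrable_normal_quadratic _ _ 1) => // x; rewrite mul1r.
by rewrite ger0_norm ?sqr_ge0// lerDr.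
Qed.

Lemma std_normal_integration_by_parts i (h h' : ('I_m -> R) -> R)
    (C : ('I_m -> R) -> R) :
  coord_measurable h -> coord_measurable h' ->
  (forall x r, is_derive (r : R) 1 (fun t => h (update x i t)) (h' (update x i r))) ->
  (forall x, continuous (fun t => h' (update x i t))) ->
  (forall x r, `|h (update x i r)| <= C x * (1 + `|r|)) ->
  (forall x r, `|h' (update x i r)| <= C x) ->
  P.-integrable [set: T] (fun w => (X i w * h (X ^~ w))%:E) ->
  P.-integrable [set: T] (fun w => (h' (X ^~ w))%:E) ->
  \int[P]_w (X i w * h (X ^~ w)) = \int[P]_w h' (X ^~ w).
Proof.
move=> mh mh' dh ch' hC h'C ixh ih'.
have mxh : coord_measurable (fun x => x i * h x).
  by move=> d' T' X' mX'; apply: measurable_funM; [exact: mX'|exact: mh].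
rewrite (Rintegral_resample i mxh) (Rintegral_resample i mh').
have i1 := integrable_resample i mxh ixh.
have i2 := integrable_resample i mh' ih'.
rewrite /Rintegral -(integral12_prod_meas1 i1) -(integral12_prod_meas1 i2).
congr fine; apply: eq_integral => w _; rewrite /fubini_F /=.
rewrite -(normal_integration_by_parts (dh (X ^~ w)) (ch' _) (hC _) (h'C _)).
by apply: eq_integral => r _; rewrite {1}/update eqxx.
Qed.

(** Induction on the list of coordinates: resampling the head one pulls out its own factor exp(t_i^2
    / 2). The tail is unaffected because the list has no repetition. *)
Lemma std_normal_mgf (t : 'I_m -> R) :
  (\int[P]_w (expR (\sum_i t i * X i w))%:E =
   (expR ((\sum_i t i ^+ 2) / 2))%:E)%E.
Proof.
under eq_integral do rewrite -big_enum.
rewrite -big_enum; elim: (enum 'I_m) (enum_uniq 'I_m) => [_|i s IHs /= /andP[si us]].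
  under eq_integral do rewrite big_nil expR0.
  rewrite big_nil mul0r expR0 integral_cst//=.
  by rewrite mul1e; exact: probability_setT.
pose h (x : 'I_m -> R) := expR (\sum_(k <- i :: s) t k * x k).
have mh : coord_measurable h.
  move=> d' T' X' mX'; apply: measurableT_comp => //.
  by apply: measurable_sum => k; exact: measurable_funM.
rewrite (@ge0_integral_resample i h)//; last by move=> x; exact: expR_ge0.
under eq_integral => w _.
  under eq_integral => r _.
    rewrite /h big_cons expRD {1}/update eqxx.
    rewrite (eq_big_seq (fun k => t k * X k w)) => [|k ks]; last first.
      by rewrite /update; case: eqP => // E; move: si; rewrite -E ks.
    rewrite mulrC EFinM.
    over.
  rewrite integralZl//; last exact: integrable_expR_normal.
  rewrite normal_prob_mgf muleC.
  over.
rewrite /= ge0_integralZl//; last first.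
  apply/measurable_EFinP/measurableT_comp => //.
  by apply: measurable_sum => k; apply: measurable_funM => //; exact: mX.
by rewrite IHs// -EFinM -expRD big_cons; congr (expR _)%:E; ring.
Qed.

End std_normal_family.

Section integration_helpers.
Context d (T : measurableType d) (R : realType).

Lemma integrableM_bounded (mu : {measure set T -> \bar R}) (f g : T -> R) (C : R) :
  mu.-integrable [set: T] (EFin \o f) -> measurable_fun [set: T] g ->
  (forall x, `|g x| <= C) ->
  mu.-integrable [set: T] (fun x => (f x * g x)%:E).
Proof.
move=> fi mg gC; have mf : measurable_fun [set: T] f.
  by apply/measurable_EFinP; exact: measurable_int fi.
apply: (le_integrable measurableT _ _ (integrableZl measurableT C fi)).
  by apply/measurable_EFinP; exact: measurable_funM.
move=> x _; rewrite /= lee_fin !normrM mulrC ler_wpM2r//.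
exact: le_trans (gC x) (ler_norm _).
Qed.

Lemma integrable_bounded (mu : {finite_measure set T -> \bar R}) (g : T -> R) (C : R) :
  measurable_fun [set: T] g -> (forall x, `|g x| <= C) ->
  mu.-integrable [set: T] (EFin \o g).
Proof.
move=> mg gC; apply: measurable_bounded_integrable => //.
  by rewrite ltey_eq fin_num_measure.
exists C; split; first exact: num_real.
by move=> x Cx y _ /=; rewrite (le_trans (gC y))// ltW.
Qed.

Lemma integrable_sum_fin (mu : {measure set T -> \bar R}) I (s : seq I) (f : I -> T -> R) :
  (forall i, mu.-integrable [set: T] (EFin \o f i)) ->
  mu.-integrable [set: T] (fun x => (\sum_(i <- s) f i x)%:E).
Proof.
move=> fi; under eq_fun do rewrite -sumEFin.
by apply: (@integrable_sum _ _ _ mu _ measurableT I s xpredT (fun i x => (f i x)%:E)) => i _; exact: fi.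
Qed.

Lemma Rintegral_sum (mu : {measure set T -> \bar R}) I (s : seq I) (f : I -> T -> R) :
  (forall i, mu.-integrable [set: T] (EFin \o f i)) ->
  \int[mu]_x (\sum_(i <- s) f i x) = \sum_(i <- s) \int[mu]_x f i x.
Proof.
move=> fi; elim: s => [|i s IHs].
  rewrite big_nil; under eq_Rintegral do rewrite big_nil.
  by rewrite /Rintegral integral0.
rewrite big_cons -IHs -RintegralD//; last exact: integrable_sum_fin.
by apply: eq_Rintegral => x _; rewrite big_cons.
Qed.

End integration_helpers.

(** * Linear images of standard normal families *)

Section linear_image.
Context (R : realType) d (T : measurableType d) (P : probability T R).
Variables (m p : nat) (X : 'I_m -> T -> R) (a : 'I_m -> 'I_p -> R).
Hypothesis HX : std_normal_family P X.
Local Notation gamma := (normal_prob (0 : R) 1).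

Definition linear_image (j : 'I_p) (w : T) : R := \sum_i a i j * X i w.
(** The covariance matrix of the linear image, as [Rintegral_linear_imageM] confirms. *)
Definition gram (j k : 'I_p) : R := \sum_i a i j * a i k.
Local Notation Y := linear_image.

Lemma measurable_linear_image j : measurable_fun [set: T] (Y j).
Proof.
by apply: measurable_sum => i; apply: measurable_funM => //; exact: HX.1.
Qed.

Lemma integrable_linear_image j : P.-integrable [set: T] (EFin \o Y j).
Proof.
apply: integrable_sum_fin => i.
exact: integrableZl (integrable_coordinate1 HX i).
Qed.

Lemma linear_image_mgf t j : gram j j = 1 ->
  (\int[P]_w (expR (t * Y j w))%:E = (expR (t ^+ 2 / 2))%:E)%E.
Proof.
move=> g1; under eq_integral => w _.
  rewrite /linear_image big_distrr/=.
  under eq_bigr do rewrite mulrA.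
  over.
rewrite (std_normal_mgf HX (fun i => t * a i j)).
have -> : \sum_i (t * a i j) ^+ 2 = t ^+ 2 * gram j j.
  by rewrite /gram big_distrr/=; apply: eq_bigr => i _; ring.
by rewrite g1 mulr1.
Qed.

Lemma sum_update (c : 'I_m -> R) x i t :
  \sum_l c l * update x i t l = c i * t + (\sum_(l | l != i) c l * x l).
Proof.
rewrite (bigD1 i)//= {1}/update eqxx; congr (_ + _).
by apply: eq_bigr => l /negbTE li; rewrite /update li.
Qed.

(** Expand Y_j in the X_i, integrate by parts in each X_i with the chain rule, and regroup the
    products a_ij a_ik into the covariance. Working through X covers singular covariances. The
    affine argument is there for the rotation: s is its sine, and b collects what is frozen when V
    is given. *)
Lemma linear_image_integration_by_parts (h : ('I_p -> R) -> R) dh (C s : R)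
    (b : 'I_p -> R) j :
  has_grad h dh -> coord_measurable h -> (forall k, coord_measurable (dh k)) ->
  (forall k, coordwise_continuous (dh k)) ->
  (forall u, `|h u| <= C) -> (forall k u, `|dh k u| <= C) ->
  \int[P]_w (Y j w * h (fun k => s * Y k w + b k)) =
  s * \sum_k gram j k * \int[P]_w dh k (fun k => s * Y k w + b k).
Proof.
move=> gh mh mdh cdh hC dhC.
pose u (x : 'I_m -> R) (k : 'I_p) := s * (\sum_l a l k * x l) + b k.
have mu d' (T' : measurableType d') (X' : 'I_m -> T' -> R) k :
    (forall i, measurable_fun [set: T'] (X' i)) ->
    measurable_fun [set: T'] (fun w => u (X' ^~ w) k).
  move=> mX'; apply: measurable_funD => //; apply: measurable_funM => //.
  by apply: measurable_sum => l; exact: measurable_funM.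
pose H x := h (u x).
pose H' i x := \sum_k dh k (u x) * (s * a i k).
have mH : coord_measurable H.
  by move=> d' T' X' mX'; apply: mh => k; exact: mu.
have mdhu k : coord_measurable (fun x => dh k (u x)).
  by move=> d' T' X' mX'; apply: mdh => l; exact: mu.
have mH' i : coord_measurable (H' i).
  by move=> d' T' X' mX'; apply: measurable_sum => k; apply: measurable_funM => //; exact: mdhu.
have C0 : 0 <= C by apply: le_trans (hC (fun=> 0)).
(* A single constant dominating both h and its derivative along the i-th coordinate. *)
pose D i := C + \sum_k C * `|s * a i k|.
have DC i : C <= D i by rewrite lerDl sumr_ge0// => k _; rewrite mulr_ge0.
have H'D i x : `|H' i x| <= D i.
  apply: le_trans (ler_norm_sum _ _ _) _; apply: ler_wpDl => //.
  by apply: ler_sum => k _; rewrite normrM ler_wpM2r.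
have idh k : P.-integrable [set: T] (EFin \o (fun w => dh k (u (X ^~ w)))).
  by apply: (@integrable_bounded _ _ _ _ _ C) => //; apply: mdhu; exact: HX.1.
have ixH i : P.-integrable [set: T] (fun w => (X i w * H (X ^~ w))%:E).
  apply: (@integrableM_bounded _ _ _ _ _ _ C) => //.
  - exact: integrable_coordinate1 HX i.
  - by apply: mH; exact: HX.1.
  - by move=> w; exact: hC.
have ibp i : \int[P]_w (X i w * H (X ^~ w)) = \int[P]_w H' i (X ^~ w).
  apply: (@std_normal_integration_by_parts _ _ _ _ _ _ HX i H (H' i) (fun=> D i)) => //.
  - move=> x r.
    have dU k : is_derive (r : R) 1 (fun t => u (update x i t) k) (s * a i k).
      rewrite (_ : (fun _ => _) = fun t => (s * a i k) * t +
          (s * (\sum_(l | l != i) a l k * x l) + b k)); last first.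
        by apply/funext => t; rewrite /u sum_update; ring.
      exact: is_derive_affine_pt.
    exact: gh (fun k t => u (update x i t) k) _ r dU.
  - move=> x; apply: continuous_big => //; first exact: add_continuous.
    move=> k _ t; apply: cvgM; last exact: cvg_cst.
    apply: (cdh k _ (fun l t => u (update x i t) l)) => l {}t.
    rewrite /u (_ : (fun _ => _) = fun t => (s * a i l) * t +
        (s * (\sum_(k | k != i) a k l * x k) + b l)); last first.
      by apply/funext => t'; rewrite sum_update; ring.
    apply: cvgD; last exact: cvg_cst.
    by apply: cvgM; [exact: cvg_cst|exact: cvg_id].
  - move=> x r; rewrite (le_trans (hC _))// (le_trans (DC i))//.
    by rewrite ler_peMr ?lerDl// (le_trans _ (DC i)).
  - apply: (@integrable_bounded _ _ _ _ _ (D i)) => //.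
    by apply: mH'; exact: HX.1.
transitivity (\sum_i a i j * \int[P]_w H' i (X ^~ w)).
  transitivity (\sum_i \int[P]_w (a i j * (X i w * H (X ^~ w)))); last first.
    apply: eq_bigr => i _; rewrite -ibp RintegralZl//; exact: ixH.
  rewrite -Rintegral_sum; last first.
    by move=> i; exact: (integrableZl measurableT (a i j) (ixH i)).
  apply: eq_Rintegral => w _; rewrite /linear_image big_distrl/=.
  by apply: eq_bigr => i _; rewrite mulrA.
have IH' i : \int[P]_w H' i (X ^~ w) =
    \sum_k s * a i k * \int[P]_w dh k (u (X ^~ w)).
  rewrite Rintegral_sum; last first.
    by move=> k; exact: (integrableZr measurableT (s * a i k) (idh k)).
  by apply: eq_bigr => k _; rewrite RintegralZr// mulrC.
under eq_bigr => i _ do rewrite IH' big_distrr/=.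
rewrite exchange_big/= big_distrr/=; apply: eq_bigr => k _.
rewrite /gram big_distrl big_distrr/=; apply: eq_bigr => i _.
rewrite /u; ring.
Qed.

End linear_image.

Section second_moments.
Context (R : realType) d (T : measurableType d) (P : probability T R).
Variables (m : nat) (X : 'I_m -> T -> R).
Hypothesis HX : std_normal_family P X.

Lemma Rintegral_coordinate i : \int[P]_w X i w = 0.
Proof.
have := @std_normal_integration_by_parts _ _ _ _ _ _ HX i (fun=> 1) (fun=> 0) (fun=> 1).
under eq_Rintegral do rewrite mulr1.
move=> ->; first by rewrite /Rintegral integral0.
- by move=> d' T' X' _.
- by move=> d' T' X' _.
- by move=> x; exact: cst_continuous.
- by move=> x r; rewrite normr1 mul1r lerDl.
- by move=> x r; rewrite normr0.
- under eq_fun do rewrite mulr1; exact: integrable_coordinate1 HX i.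
- exact: integrable0.
Qed.

Lemma integrable_coordinateM i k :
  P.-integrable [set: T] (fun w => (X i w * X k w)%:E).
Proof.
apply: (le_integrable measurableT _ _ (integrableD measurableT
  (integrable_coordinate_sqr HX i) (integrable_coordinate_sqr HX k))).
  by apply/measurable_EFinP; apply: measurable_funM; exact: HX.1.
move=> w _; rewrite -EFinD lee_fin ler_norml.
rewrite (ger0_norm (addr_ge0 (sqr_ge0 _) (sqr_ge0 _))).
have := sqr_ge0 (X i w - X k w); have := sqr_ge0 (X i w + X k w).
by have := sqr_ge0 (X i w); have := sqr_ge0 (X k w) => *; apply/andP; split; lra.
Qed.

Lemma Rintegral_coordinateM i k : \int[P]_w (X i w * X k w) = (i == k)%:R.
Proof.
have := @std_normal_integration_by_parts _ _ _ _ _ _ HX i (fun x => x k)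
  (fun=> (i == k)%:R) (fun x => 1 + `|x k|).
rewrite Rintegral_cst// (_ : fine _ = 1); last first.
  by rewrite /= probability_setT.
rewrite mulr1; apply.
- by move=> d' T' X' mX'; exact: mX'.
- by move=> d' T' X' _.
- move=> x r; rewrite /update [k == i]eq_sym; case: eqP => _; first exact: is_derive_id.
  exact: is_derive_cst_pt.
- by move=> x; exact: cst_continuous.
- move=> x r; rewrite /update; case: eqP => _; have := normr_ge0 (x k); have := normr_ge0 r; nra.
- move=> x r; rewrite normr_nat (@le_trans _ _ 1) ?lerDl//; by case: eqP.
- exact: integrable_coordinateM.
- exact: finite_measure_integrable_cst.
Qed.

End second_moments.

(** * Anti-concentration *)

Section anti_concentration.
Context (R : realType) d (T : measurableType d) (P : probability T R).
Variables (m p : nat) (X : 'I_m -> T -> R) (a : 'I_m -> 'I_p -> R).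
Hypotheses (HX : std_normal_family P X) (p_ge2 : (2 <= p)%N).
Local Notation Y := (linear_image X a).
Local Notation rho := (gram a).

Lemma Rintegral_linear_image j : \int[P]_w Y j w = 0.
Proof.
rewrite Rintegral_sum.
  rewrite big1// => i _.
  by rewrite RintegralZl ?Rintegral_coordinate ?mulr0//; exact: integrable_coordinate1 HX i.
by move=> i; exact: integrableZl (integrable_coordinate1 HX i).
Qed.

Lemma Rintegral_linear_imageM j k : \int[P]_w (Y j w * Y k w) = rho j k.
Proof.
have I i l := integrableZl measurableT (a i j * a l k) (integrable_coordinateM HX i l).
transitivity (\int[P]_w (\sum_i \sum_l (a i j * a l k) * (X i w * X l w))).
  apply: eq_Rintegral => w _; rewrite /linear_image big_distrl/=.
  by apply: eq_bigr => i _; rewrite big_distrr/=; apply: eq_bigr => l _; ring.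
rewrite Rintegral_sum; last by move=> i; apply: integrable_sum_fin => l; exact: I.
apply: eq_bigr => i _; rewrite Rintegral_sum; last by move=> l; exact: I.
rewrite (bigD1 i)//= big1 ?addr0.
  by rewrite RintegralZl ?Rintegral_coordinateM ?eqxx ?mulr1//; exact: integrable_coordinateM.
move=> l li; rewrite RintegralZl//; last exact: integrable_coordinateM.
by rewrite Rintegral_coordinateM// eq_sym (negbTE li) mulr0.
Qed.

Hypothesis gram1 : forall j, rho j j = 1.

(** Unit variances turn the nonnegative squared distance between columns j and k into 2 - 2
    rho_jk. *)
Lemma gram_le1 j k : rho j k <= 1.
Proof.
suff : 0 <= rho j j + rho k k - 2 * rho j k by rewrite !gram1; lra.
rewrite /gram big_distrr/= -big_split/= -sumrB.
apply: sumr_ge0 => i _; have := sqr_ge0 (a i j - a i k); lra.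
Qed.

Local Notation l := (Num.sqrt (ln p%:R) : R).

(** From exp(-1/2) >= 1/2 one gets exp(1/2) <= 2 <= p. This lower bound allows additive constants to
    be absorbed into powers of ln p. *)
Lemma ln_dim_ge : 2^-1 <= ln p%:R :> R.
Proof.
have p0 : 0 < p%:R :> R by rewrite ltr0n (leq_trans _ p_ge2).
rewrite -ler_expR lnK ?posrE// (@le_trans _ _ 2)//; last by rewrite ler_nat.
have := expR_ge1Dx (- 2^-1 : R); rewrite expRN.
rewrite (_ : 1 + - 2^-1 = 2^-1 :> R); last lra.
by rewrite lef_pV2 ?posrE ?expR_gt0.
Qed.

Lemma sqrt_ln_dim_gt0 : 0 < l.
Proof. by rewrite sqrtr_gt0; have := ln_dim_ge; lra. Qed.

Lemma sqr_sqrt_ln_dim : l ^+ 2 = ln p%:R.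
Proof. by rewrite sqr_sqrtr//; have := ln_dim_ge; lra. Qed.

(** A maximal inequality in disguise: the weights may depend on Y, but each |Y_j| has the majorant 2
    l + Z / (l p^2), free of j, with Z the sum over k of exp(l Y_k) + exp(- l Y_k). It comes from y
    <= exp y at y = l (|Y_j| - 2 l), as exp(2 l^2) = p^2. The mean of Z is at most 2 p^2, and 2 / l
    <= 4 l because l^2 >= 1/2; the total is 6 l. *)
Lemma weighted_mean_le (v : 'I_p -> T -> R) :
  (forall j, measurable_fun [set: T] (v j)) -> (forall j w, 0 <= v j w) ->
  (forall w, \sum_j v j w = 1) ->
  \int[P]_w (\sum_j v j w * `|Y j w|) <= 6 * l.
Proof.
move=> mv v0 v1.
have l0 := sqrt_ln_dim_gt0; have l2 := sqr_sqrt_ln_dim.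
have v_le1 j w : `|v j w| <= 1.
  by rewrite ger0_norm// -(v1 w) (bigD1 j)//= lerDl sumr_ge0.
have p0 : 0 < p%:R :> R by rewrite ltr0n (leq_trans _ p_ge2).
have iE t j : P.-integrable [set: T] (fun w => (expR (t * Y j w))%:E).
  apply/integrableP; split.
    apply/measurable_EFinP/measurableT_comp => //.
    by apply: measurable_funM => //; exact: (measurable_linear_image _ HX).
  under eq_integral do rewrite gee0_abs ?lee_fin ?expR_ge0//.
  by rewrite (linear_image_mgf HX)// ltry.
pose Z w := \sum_k (expR (l * Y k w) + expR (- l * Y k w)).
have iZk k : P.-integrable [set: T] (fun w => (expR (l * Y k w) + expR (- l * Y k w))%:E).
  exact: (integrableD measurableT (iE l k) (iE (- l) k)).
have iZ : P.-integrable [set: T] (EFin \o Z).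
  exact: integrable_sum_fin.
have EZ : \int[P]_w Z w = p%:R * (2 * expR (ln p%:R / 2)).
  rewrite Rintegral_sum; last exact: iZk.
  rewrite (eq_bigr (fun=> 2 * expR (ln p%:R / 2))).
    by rewrite sumr_const card_ord -[LHS]mulr_natl.
  move=> k _; rewrite RintegralD//; [|exact: iE|exact: iE].
  by rewrite /Rintegral !(linear_image_mgf HX)//= sqrrN l2; ring.
have iB : P.-integrable [set: T] (fun w => (2 * l + (l * p%:R ^+ 2)^-1 * Z w)%:E).
  have := integrableD measurableT (finite_measure_integrable_cst P (2 * l) measurableT)
    (integrableZl measurableT (l * p%:R ^+ 2)^-1 iZ).
  exact.
have iV : P.-integrable [set: T] (fun w => (\sum_j v j w * `|Y j w|)%:E).
  apply: integrable_sum_fin => j.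
  under eq_fun do rewrite mulrC.
  apply: (@integrableM_bounded _ _ _ _ _ _ 1) => //.
  exact: integrable_norm (integrable_linear_image a HX j).
apply: le_trans (le_Rintegral measurableT iV iB _) _.
  move=> w _; set B := (X in _ <= X).
  have -> : B = \sum_j v j w * B by rewrite -big_distrl/= v1 mul1r.
  rewrite /B; apply: ler_sum => j _; rewrite ler_wpM2l//.
  have H1 : l * (`|Y j w| - 2 * l) <= expR (l * (`|Y j w| - 2 * l)).
    by have := expR_ge1Dx (l * (`|Y j w| - 2 * l)); lra.
  have H2 : expR (l * `|Y j w|) <= Z w.
    rewrite /Z (bigD1 j)//=; apply: ler_wpDr.
      by apply: sumr_ge0 => k _; rewrite addr_ge0 ?expR_ge0.
    case: ger0P => _; first by rewrite lerDl expR_ge0.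
    by rewrite mulrN mulNr lerDr expR_ge0.
  have H3 : expR (l * (`|Y j w| - 2 * l)) = expR (l * `|Y j w|) / p%:R ^+ 2.
    rewrite mulrBr expRD; congr (_ * _).
    by rewrite expRN mulrCA -expr2 l2 expRM_natl lnK// posrE.
  rewrite H3 in H1.
  have H4 : l * (`|Y j w| - 2 * l) <= Z w / p%:R ^+ 2.
    by apply: le_trans H1 _; rewrite ler_pM2r// invr_gt0 exprn_gt0.
  rewrite -lerBlDl invfM -mulrA ler_pdivlMl// [_^-1 * Z w]mulrC.
  exact: H4.
rewrite RintegralD//; last 2 first.
- exact: finite_measure_integrable_cst.
- exact: (integrableZl measurableT (l * p%:R ^+ 2)^-1 iZ).
rewrite (RintegralZl _ measurableT iZ) EZ Rintegral_cst// (_ : fine _ = 1); last first.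
  by rewrite /= probability_setT.
have H5 : expR (ln p%:R / 2) <= p%:R :> R.
  rewrite -[leRHS]lnK ?posrE// ler_expR.
  by have := ln_dim_ge; lra.
rewrite mulr1.
have -> : (l * p%:R ^+ 2)^-1 * (p%:R * (2 * expR (ln p%:R / 2))) =
    2 / l * (expR (ln p%:R / 2) / p%:R).
  by field; rewrite !gt_eqF.
have H6 : 2 / l * (expR (ln p%:R / 2) / p%:R) <= 2 / l.
  rewrite -[leRHS]mulr1 ler_wpM2l ?divr_ge0 ?(ltW l0)//.
  by rewrite ler_pdivrMr// mul1r.
have H7 : 2 / l <= 4 * l.
  by rewrite ler_pdivrMr// -mulrA -expr2 l2; have := ln_dim_ge; lra.
lra.
Qed.

(* Gaussian integration by parts applied to [atan (u_j / delta) + pi / 2] times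
   the j-th softmax weight: since all correlations are at most 1, the j-th weight
   is nondecreasing in the direction [gram j], so that its contribution has a
   sign and can be dropped. *)
Lemma anti_concentration (beta delta s : R) (b : 'I_p -> R) :
  0 < beta -> 0 < delta -> 0 < s ->
  \int[P]_w mean_bump beta delta (fun k => s * Y k w + b k) <=
  delta / s * (6 * pi * l).
Proof.
move=> beta0 delta0 s0.
have p_gt0 : (0 < p)%N by rewrite (leq_trans _ p_ge2).
pose w_ j := @softmax_weight R p beta j.
have w0 j u : 0 <= w_ j u by exact: softmax_weight_ge0.
have w_le1 j u : w_ j u <= 1 by exact: softmax_weight_le1.
pose A r : R := atan r + pi / 2.
have A0 r : 0 <= A r by have /andP[] := atan_pi_bounds r.
have A_lepi r : A r <= pi by have /andP[] := atan_pi_bounds r.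
have pi0 : 0 < pi :> R by exact: pi_gt0.
pose h j (u : 'I_p -> R) := A (delta^-1 * u j) * w_ j u.
pose dh (j k : 'I_p) (u : 'I_p -> R) :=
  cauchy_bump (delta^-1 * u j) * (delta^-1 * (j == k)%:R) * w_ j u +
  A (delta^-1 * u j) * (beta * w_ j u * ((j == k)%:R - w_ k u)).
have gh j : has_grad (h j) (dh j).
  apply: has_gradM; last exact: has_grad_softmax_weight.
  apply: (has_grad_comp (g := A)) => [u|]; first exact: is_derive_atan_bump.
  exact/has_gradZ/has_grad_coord.
have cA : continuous A.
  move=> x; apply/differentiable_continuous/derivable1_diffP.
  by case: (is_derive_atan_bump x).
have mAu j d' (T' : measurableType d') (X' : 'I_p -> T' -> R) :
    (forall k, measurable_fun [set: T'] (X' k)) ->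
    measurable_fun [set: T'] (fun w => A (delta^-1 * X' j w)).
  move=> mX'; apply: measurableT_comp; last exact: measurable_funM.
  exact: continuous_measurable_fun.
have mbu j d' (T' : measurableType d') (X' : 'I_p -> T' -> R) :
    (forall k, measurable_fun [set: T'] (X' k)) ->
    measurable_fun [set: T'] (fun w => cauchy_bump (delta^-1 * X' j w)).
  move=> mX'; apply: measurableT_comp; last exact: measurable_funM.
  by apply: continuous_measurable_fun; exact: continuous_cauchy_bump.
have mw j : coord_measurable (w_ j) by exact: coord_measurable_softmax_weight.
have mh j : coord_measurable (h j).
  by move=> d' T' X' mX'; apply: measurable_funM; [exact: mAu|exact: mw].
have mdh j k : coord_measurable (dh j k).
  move=> d' T' X' mX'; apply: measurable_funD; apply: measurable_funM.
  - by apply: measurable_funM => //; exact: mbu.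
  - exact: mw.
  - exact: mAu.
  - apply: measurable_funM; first by apply: measurable_funM => //; exact: mw.
    by apply: measurable_funB => //; exact: mw.
have cdh j k : coordwise_continuous (dh j k).
  move=> T' X' cX' x.
  have cu : {for x, continuous (fun x => delta^-1 * X' j x)}.
    by apply: cvgM; [exact: cvg_cst|exact: cX'].
  have cw i : {for x, continuous (fun x => w_ i (X' ^~ x))}.
    exact: coord_continuous_softmax_weight.
  apply: cvgD; apply: cvgM.
  - apply: cvgM; last exact: cvg_cst.
    by apply: (continuous_comp cu); exact: continuous_cauchy_bump.
  - exact: cw.
  - by apply: (continuous_comp cu); exact: cA.
  - apply: cvgM; first by apply: cvgM; [exact: cvg_cst|exact: cw].
    by apply: cvgB; [exact: cvg_cst|exact: cw].
(* A crude common bound, required for integrability and integration by parts; it does not enter the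
   final estimate. *)
pose C : R := delta^-1 + pi * beta + pi.
have b01 (j k : 'I_p) : 0 <= ((j == k)%:R : R) <= 1 by rewrite ler0n lern1 leq_b1.
have hC j u : `|h j u| <= C.
  rewrite ger0_norm ?mulr_ge0// (@le_trans _ _ (pi * 1))//.
    exact: ler_pM.
  rewrite mulr1 /C lerDr addr_ge0 ?mulr_ge0 ?invr_ge0 ?(ltW pi0) ?(ltW beta0) ?(ltW delta0)//.
have dhC j k u : `|dh j k u| <= C.
  have /andP[B0 B1] := (b01 j k).
  have k0 := cauchy_bump_gt0 (delta^-1 * u j); have k1 := cauchy_bump_le1 (delta^-1 * u j).
  apply: (le_trans (ler_normD _ _)); rewrite /C -addrA; apply: lerD.
    rewrite ger0_norm; last by rewrite !mulr_ge0 ?(ltW k0) ?invr_ge0 ?(ltW delta0).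
    rewrite -[leRHS]mul1r -[leRHS]mulr1 ler_pM//.
      by rewrite !mulr_ge0 ?(ltW k0) ?invr_ge0 ?(ltW delta0).
    rewrite ler_pM ?(ltW k0)//; first by rewrite mulr_ge0// invr_ge0 (ltW delta0).
    by rewrite ler_piMr// invr_ge0 (ltW delta0).
  rewrite (@le_trans _ _ (pi * beta))//; last by rewrite lerDl ltW.
  rewrite normrM (ger0_norm (A0 _)) ler_pM//.
  rewrite -mulrA normrM (gtr0_norm beta0) ler_piMr ?(ltW beta0)// normrM (ger0_norm (w0 _ _)).
  rewrite mulr_ile1// ler_norml; have := w0 k u; have := w_le1 k u; lra.
pose u w (k : 'I_p) := s * Y k w + b k.
have mu k : measurable_fun [set: T] (fun w => u w k).
  by apply: measurable_funD => //; apply: measurable_funM => //; exact: (measurable_linear_image _ HX).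
pose bump j w := w_ j (u w) * cauchy_bump (u w j / delta).
have ibump j : P.-integrable [set: T] (EFin \o bump j).
  apply: (@integrable_bounded _ _ _ _ _ 1).
    apply: measurable_funM; first exact: mw.
    rewrite (_ : (fun x => _) = fun x => cauchy_bump (delta^-1 * u x j)).
      exact: (mbu j _ _ (fun k w => u w k)).
    by apply/funext => x; rewrite mulrC.
  move=> w; have k0 := cauchy_bump_gt0 (u w j / delta).
  by rewrite ger0_norm ?mulr_ge0 ?(ltW k0)// mulr_ile1 ?(ltW k0)// cauchy_bump_le1.
have iYh j : P.-integrable [set: T] (fun w => (Y j w * h j (u w))%:E).
  apply: (@integrableM_bounded _ _ _ _ _ _ C) => //.
    exact: integrable_linear_image.
  exact: mh.
have idh j k : P.-integrable [set: T] (fun w => (dh j k (u w))%:E).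
  by apply: (@integrable_bounded _ _ _ _ _ C) => //; exact: mdh.
have step j : s / delta * \int[P]_w bump j w <= \int[P]_w (Y j w * h j (u w)).
  rewrite (linear_image_integration_by_parts a HX s b j (gh j) (mh j) (mdh j) (cdh j) (hC j) (dhC j)).
  rewrite -mulrA ler_pM2l//.
  have -> : \sum_k rho j k * \int[P]_w dh j k (u w) =
      \int[P]_w (\sum_k rho j k * dh j k (u w)).
    rewrite Rintegral_sum; last by move=> k; exact: (integrableZl measurableT (rho j k) (idh j k)).
    by apply: eq_bigr => k _; rewrite RintegralZl//; exact: idh.
  rewrite -RintegralZl//.
  apply: le_Rintegral => //.
  - exact: (integrableZl measurableT delta^-1 (ibump j)).
  - apply: integrable_sum_fin => k.
    exact: (integrableZl measurableT (rho j k) (idh j k)).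
  move=> w _; rewrite /dh /bump.
  (* The factor 1 - sum_k rho_jk w_k is nonnegative because the weights sum to 1, so only the bump
     term has to be kept. *)
  have -> : \sum_k rho j k * (cauchy_bump (delta^-1 * u w j) * (delta^-1 * (j == k)%:R) * w_ j (u w) +
      A (delta^-1 * u w j) * (beta * w_ j (u w) * ((j == k)%:R - w_ k (u w)))) =
    delta^-1 * (w_ j (u w) * cauchy_bump (u w j / delta)) +
    A (delta^-1 * u w j) * (beta * w_ j (u w)) *
      (1 - \sum_k rho j k * w_ k (u w)).
    rewrite (bigD1 j)//= eqxx gram1 [in RHS](bigD1 j)//= gram1 [u w j / _]mulrC.
    rewrite (eq_bigr (fun k => - (A (delta^-1 * u w j) * (beta * w_ j (u w))) *
       (rho j k * w_ k (u w)))) => [|k kj]; last first.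
      by rewrite eq_sym (negbTE kj) mulr0n; ring.
    by rewrite -big_distrr/=; ring.
  rewrite lerDl !mulr_ge0 ?(ltW beta0)// subr_ge0.
  rewrite -(sum_softmax_weight beta p_gt0 (u w)); apply: ler_sum => k _.
  by rewrite ler_piMl// gram_le1.
have -> : \int[P]_w mean_bump beta delta (u w) = \sum_j \int[P]_w bump j w.
  by rewrite -Rintegral_sum.
rewrite mulrC -[X in _ <= X]/(_ * _).
have sd0 : 0 < s / delta by rewrite divr_gt0.
rewrite -(ler_pM2l sd0) big_distrr/=.
rewrite (_ : s / delta * (6 * pi * l * (delta / s)) = 6 * pi * l); last first.
  by field; rewrite !gt_eqF.
apply: (le_trans (ler_sum _ (fun j _ => step j))).
rewrite -Rintegral_sum//.
have iV : P.-integrable [set: T] (fun w => (\sum_j w_ j (u w) * `|Y j w|)%:E).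
  apply: integrable_sum_fin => j.
  under eq_fun do rewrite mulrC.
  apply: (@integrableM_bounded _ _ _ _ _ _ 1) => //.
  - exact: integrable_norm (integrable_linear_image a HX j).
  - exact: mw.
  - by move=> w; rewrite ger0_norm.
(* The shifted arc tangent is at most pi. What remains is a weighted mean of the |Y_j|, so that the
   sum over j costs sqrt(ln p) and no power of p. *)
apply: (@le_trans _ _ (\int[P]_w (pi * (\sum_j w_ j (u w) * `|Y j w|)))).
  apply: le_Rintegral => //.
  - exact: integrable_sum_fin.
  - exact: (integrableZl measurableT pi iV).
  move=> w _; rewrite big_distrr/=; apply: ler_sum => j _.
  rewrite /h mulrA mulrC [pi * _]mulrCA ler_wpM2l//.
  apply: (@le_trans _ _ (`|Y j w| * A (delta^-1 * u w j))).
    by rewrite ler_wpM2r// ler_norm.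
  by rewrite mulrC ler_wpM2r.
rewrite RintegralZl// (mulrC 6) -mulrA ler_pM2l//.
apply: weighted_mean_le => // [j|w]; first exact: mw.
by rewrite sum_softmax_weight.
Qed.

End anti_concentration.

(** * Interpolation *)

Section product_integrals.
Context (R : realType) d (T : measurableType d) (P : probability T R)
  d' (T' : measurableType d') (P' : probability T' R).

Lemma integrable_fst (f : T -> R) : P.-integrable [set: T] (EFin \o f) ->
  (P \x P')%E.-integrable [set: T * T'] (fun z => (f z.1)%:E).
Proof.
move=> fi; have mf := measurable_int _ fi.
apply: (integrable_same_law (P1 := P) (P2 := (P \x P')%E) (@measurable_id _ _ setT)
  (@measurable_fst _ _ T T') _ mf) => // A mA.
have -> : fst @^-1` A = A `*` [set: T'].
  by apply/seteqP; split => -[x y] //= -[].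
transitivity (P A * P' setT)%E; first by rewrite probability_setT mule1.
by apply/esym; exact: product_measure1E.
Qed.

Lemma integrable_snd (f : T' -> R) : P'.-integrable [set: T'] (EFin \o f) ->
  (P \x P')%E.-integrable [set: T * T'] (fun z => (f z.2)%:E).
Proof.
move=> fi; have mf := measurable_int _ fi.
apply: (integrable_same_law (P1 := P') (P2 := (P \x P')%E) (@measurable_id _ _ setT)
  (@measurable_snd _ _ T T') _ mf) => // A mA.
have -> : snd @^-1` A = [set: T] `*` A.
  by apply/seteqP; split => -[x y] //= -[].
transitivity (P setT * P' A)%E; first by rewrite probability_setT mul1e.
by apply/esym; exact: product_measure1E.
Qed.

Lemma integrable_prod_bounded (f : T * T' -> R) (C : R) :
  measurable_fun [set: T * T'] f -> (forall z, `|f z| <= C) ->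
  (P \x P')%E.-integrable [set: T * T'] (EFin \o f).
Proof.
move=> mf fC; have i1 := integrable_fst (finite_measure_integrable_cst P 1 measurableT).
have := integrableM_bounded i1 mf fC.
by apply: eq_integrable => // z _; rewrite /= mul1r.
Qed.

Lemma Rintegral_prod12 (f : T * T' -> R) :
  (P \x P')%E.-integrable [set: T * T'] (EFin \o f) ->
  (forall x, P'.-integrable [set: T'] (fun y => (f (x, y))%:E)) ->
  \int[(P \x P')%E]_z f z = \int[P]_x \int[P']_y f (x, y).
Proof.
move=> fi fi2; rewrite /Rintegral -(integral12_prod_meas1 fi).
congr fine; apply: eq_integral => x _; rewrite /fubini_F /=.
by rewrite fineK// integrable_fin_num.
Qed.

Lemma Rintegral_prod21 (f : T * T' -> R) :
  (P \x P')%E.-integrable [set: T * T'] (EFin \o f) ->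
  (forall y, P.-integrable [set: T] (fun x => (f (x, y))%:E)) ->
  \int[(P \x P')%E]_z f z = \int[P']_y \int[P]_x f (x, y).
Proof.
move=> fi fi2; rewrite /Rintegral -(integral21_prod_meas1 fi).
congr fine; apply: eq_integral => y _; rewrite /fubini_G /=.
by rewrite fineK// integrable_fin_num.
Qed.

End product_integrals.

Section interpolation.
Context (R : realType) d (T : measurableType d) (P : probability T R)
  d' (T' : measurableType d') (P' : probability T' R).
Variables (m p : nat) (X : 'I_m -> T' -> R) (a : 'I_m -> 'I_p -> R).
Hypotheses (HX : std_normal_family P' X) (p_ge2 : (2 <= p)%N).
Hypothesis gram1 : forall j, gram a j j = 1.
Variables (v : 'I_p -> T -> R) (tau : 'I_p -> 'I_p -> T -> R) (D : T -> R).
Hypotheses (iv : forall j, P.-integrable [set: T] (EFin \o v j))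
  (mtau : forall j k, measurable_fun [set: T] (tau j k))
  (iD : P.-integrable [set: T] (EFin \o D))
  (tauD : forall j k w, `|tau j k w - gram a j k| <= D w).
Variables (beta delta : R).
Hypotheses (beta_gt0 : 0 < beta) (delta_gt0 : 0 < delta)
  (beta_delta : beta * delta = ln p%:R).

Local Notation Y := (linear_image X a).
Local Notation rho := (gram a).
Local Notation f := (@test_fun R p beta delta).
Local Notation f1 := (@test_grad R p beta delta).
Local Notation f2 := (@test_hess R p beta delta).
Local Notation mu := (P \x P')%E.

(** Stein's identity in the form the rotation needs: c is its cosine, and b holds the Gaussian part
    and the corner. One factor c from the chain rule has been cancelled, whence the condition on c;
    it holds at interior angles. *)
Hypothesis stein : forall (c : R) (b : 'I_p -> R), c != 0 ->
  \sum_j \int[P]_w (f1 j (fun k => c * v k w + b k) * v j w) =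
  c * \sum_j \sum_k \int[P]_w (f2 j k (fun k => c * v k w + b k) * tau j k w).

Variable eta : 'I_p -> R.

Let p_gt0 : (0 < p)%N. Proof. exact: leq_trans p_ge2. Qed.

Let mv j : measurable_fun [set: T] (v j).
Proof. by apply/measurable_EFinP; exact: measurable_int (iv j). Qed.

Let mY j : measurable_fun [set: T'] (Y j).
Proof. exact: (measurable_linear_image a HX). Qed.

(** The rotation seen from the corner eta, grouped as an affine image of v for Stein's identity;
    [UE] regroups it as an affine image of Y for the Gaussian one. *)
Let U (th : R) (z : T * T') (k : 'I_p) : R :=
  cos th * v k z.1 + (sin th * Y k z.2 - eta k).

Let mvf k : measurable_fun [set: T * T'] (fun z => v k z.1).
Proof. by apply: (measurableT_comp (f := v k)) => //; exact: measurable_fst. Qed.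

Let mYs k : measurable_fun [set: T * T'] (fun z => Y k z.2).
Proof. by apply: (measurableT_comp (f := Y k)) => //; exact: measurable_snd. Qed.

Let mU th k : measurable_fun [set: T * T'] (fun z => U th z k).
Proof.
apply: measurable_funD; first exact: measurable_funM.
by apply: measurable_funB => //; exact: measurable_funM.
Qed.

Let C1 : R := 10 / delta.
Let C2 : R := 10 * (delta^-1 ^+ 2 + 2 * beta / delta).

Let C2_ge0 : 0 <= C2.
Proof.
rewrite /C2 mulr_ge0// addr_ge0 ?sqr_ge0// divr_ge0 ?(ltW delta_gt0)//.
by rewrite mulr_ge0// ltW.
Qed.

Let f1C j u : `|f1 j u| <= C1.
Proof. exact: normr_test_grad p_gt0 delta_gt0 j u. Qed.

Let f2C j k u : `|f2 j k u| <= C2.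
Proof. exact: test_hess_bounded. Qed.

Let itau j k : P.-integrable [set: T] (EFin \o tau j k).
Proof.
have i1 : P.-integrable [set: T] (fun w => (tau j k w - rho j k)%:E).
  apply: (le_integrable measurableT _ _ iD).
    by apply/measurable_EFinP; exact: measurable_funB.
  by move=> w _; rewrite lee_fin (le_trans (tauD j k w))// ler_norm.
have := integrableD measurableT i1 (finite_measure_integrable_cst P (rho j k) measurableT).
by apply: eq_integrable => // w _; rewrite /= -EFinD subrK.
Qed.

Let derf z th : is_derive (th : R) 1 (fun t => f (U t z))
  (\sum_k f1 k (U th z) * (- sin th * v k z.1 + cos th * Y k z.2)).
Proof.
apply: (has_grad_test_fun delta p_gt0 beta_gt0 (U := fun k t => U t z k)) => k.
have := is_deriveD_pt (is_deriveM_pt (is_derive_cos th) (is_derive_cst_pt (v k z.1) th))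
  (is_deriveB_pt (is_deriveM_pt (is_derive_sin th) (is_derive_cst_pt (Y k z.2) th)) (is_derive_cst_pt (eta k) th)).
by move=> H; apply: is_derive_eq H _; ring.
Qed.

Let Psi th := \int[mu]_z f (U th z).
Let G th z := \sum_k f1 k (U th z) * (- sin th * v k z.1 + cos th * Y k z.2).

Let iM : mu.-integrable [set: T * T']
  (fun z => (C1 * \sum_k (`|v k z.1| + `|Y k z.2|))%:E).
Proof.
have H : mu.-integrable [set: T * T'] (fun z => (\sum_k (`|v k z.1| + `|Y k z.2|))%:E).
  apply: integrable_sum_fin => k.
  exact: (integrableD measurableT
    (integrable_fst P' (f := fun w => `|v k w|) (integrable_norm (iv k)))
    (integrable_snd P (f := fun w => `|Y k w|)
      (integrable_norm (integrable_linear_image a HX k)))).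
exact: (integrableZl measurableT C1 H).
Qed.

Let G_le th z : `|G th z| <= C1 * \sum_k (`|v k z.1| + `|Y k z.2|).
Proof.
rewrite big_distrr/=; apply: (le_trans (ler_norm_sum _ _ _)); apply: ler_sum => k _.
rewrite normrM ler_pM//; apply: (le_trans (ler_normD _ _)); rewrite !normrM normrN.
have sin1 : `|sin th| <= 1 by rewrite ler_norml sin_geN1 sin_le1.
have cos1 : `|cos th| <= 1 by rewrite ler_norml cos_geN1 cos_le1.
by apply: lerD; rewrite ler_piMl.
Qed.

Let if_ th : mu.-integrable [set: T * T'] (fun z => (f (U th z))%:E).
Proof.
apply: (@integrable_prod_bounded _ _ _ P _ _ P' (fun z => f (U th z)) 1) => [|z].
  exact: (coord_measurable_test_fun beta delta (mU th)).
by have /andP[f0 f1] := test_fun_bounds beta delta (U th z); rewrite ger0_norm.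
Qed.

(** Differentiation under the integral sign near th. The majorant [iM] is free of the angle, sine
    and cosine being at most 1 in absolute value. *)
Let derPsi th : is_derive (th : R) 1 Psi (\int[mu]_z G th z).
Proof.
have Ia : `]th - 1, th + 1[%classic th by rewrite /= in_itv/= ltrBlDr !ltrDl ltr01.
have d1 x y : partial1of2 (fun x z => f (U x z)) x y = G x y.
  by rewrite partial1of2E; have /@derive_val := derf y x.
have dF x y : `]th - 1, th + 1[%classic x -> [set: T * T'] y ->
    derivable ((fun x z => f (U x z)) ^~ y) x 1.
  by move=> _ _; case: (derf y x).
have Gub x y : `]th - 1, th + 1[%classic x -> [set: T * T'] y ->
    `|partial1of2 (fun x z => f (U x z)) x y| <= C1 * \sum_k (`|v k y.1| + `|Y k y.2|).
  by move=> _ _; rewrite d1.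
have M0 y : 0 <= C1 * \sum_k (`|v k y.1| + `|Y k y.2|).
  exact: le_trans (normr_ge0 _) (G_le th y).
apply: DeriveDef.
  exact: (derivable_under_integral measurableT Ia (fun x _ => if_ x) dF M0 iM Gub).
rewrite -derive1E (differentiation_under_integral measurableT Ia (fun x _ => if_ x) dF M0 iM Gub).
by apply: eq_Rintegral => z _; rewrite d1.
Qed.

Let mf1U th k : measurable_fun [set: T * T'] (fun z => f1 k (U th z)).
Proof. exact: (coord_measurable_test_grad delta p_gt0 beta_gt0 k (mU th)). Qed.

Let mf2U th j k : measurable_fun [set: T * T'] (fun z => f2 j k (U th z)).
Proof. exact: (coord_measurable_test_hess delta p_gt0 beta_gt0 j k (mU th)). Qed.

Let UE th z : U th z = fun k => sin th * Y k z.2 + (cos th * v k z.1 - eta k).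
Proof. by apply/funext => k; rewrite /U; ring. Qed.

Let pair_measurable (h : ('I_p -> R) -> R) th x : coord_measurable h ->
  measurable_fun [set: T'] (fun y => h (U th (x, y))).
Proof.
move=> mh; apply: (mh _ _ (fun k y => U th (x, y) k)) => k.
rewrite /U /=; apply: measurable_funD; first exact: measurable_cst.
by apply: measurable_funB => //; exact: measurable_funM.
Qed.

Let pair_measurable' (h : ('I_p -> R) -> R) th y : coord_measurable h ->
  measurable_fun [set: T] (fun x => h (U th (x, y))).
Proof.
move=> mh; apply: (mh _ _ (fun k x => U th (x, y) k)) => k.
rewrite /U /=; apply: measurable_funD; last exact: measurable_cst.
exact: measurable_funM.
Qed.

Let mf1 k : coord_measurable (f1 k).
Proof. exact: coord_measurable_test_grad. Qed.

Let mf2 j k : coord_measurable (f2 j k).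
Proof. exact: coord_measurable_test_hess. Qed.

Let iv1 th k : mu.-integrable [set: T * T'] (fun z => (f1 k (U th z) * v k z.1)%:E).
Proof.
under eq_fun do rewrite mulrC.
exact: (integrableM_bounded (integrable_fst P' (iv k)) (mf1U th k) (fun z => f1C k _)).
Qed.

Let iY1 th k : mu.-integrable [set: T * T'] (fun z => (f1 k (U th z) * Y k z.2)%:E).
Proof.
under eq_fun do rewrite mulrC.
exact: (integrableM_bounded (integrable_snd P (integrable_linear_image a HX k))
  (mf1U th k) (fun z => f1C k _)).
Qed.

Let it2 th j k : mu.-integrable [set: T * T'] (fun z => (f2 j k (U th z) * tau j k z.1)%:E).
Proof.
under eq_fun do rewrite mulrC.
exact: (integrableM_bounded (integrable_fst P' (itau j k)) (mf2U th j k) (fun z => f2C j k _)).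
Qed.

Let ir2 th j k : mu.-integrable [set: T * T'] (fun z => (f2 j k (U th z) * rho j k)%:E).
Proof.
apply: (@integrable_prod_bounded _ _ _ P _ _ P' _ (C2 * `|rho j k|)).
  exact: measurable_funM.
by move=> z; rewrite normrM ler_wpM2r.
Qed.

(** Fubini with Y frozen: Stein's identity is applied for each value of Y, with b = sin th Y -
    eta. *)
Let stein_term th : cos th != 0 ->
  \int[mu]_z (\sum_k f1 k (U th z) * v k z.1) =
  cos th * \int[mu]_z (\sum_j \sum_k f2 j k (U th z) * tau j k z.1).
Proof.
move=> c0.
have i1 y k : P.-integrable [set: T] (fun x => (f1 k (U th (x, y)) * v k x)%:E).
  under eq_fun do rewrite mulrC.
  exact: (integrableM_bounded (iv k) (pair_measurable' th y (@mf1 k)) (fun x => f1C k _)).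
have i2 y j k : P.-integrable [set: T] (fun x => (f2 j k (U th (x, y)) * tau j k x)%:E).
  under eq_fun do rewrite mulrC.
  exact: (integrableM_bounded (itau j k) (pair_measurable' th y (@mf2 j k)) (fun x => f2C j k _)).
have iS : mu.-integrable [set: T * T']
    (EFin \o (fun z => \sum_j \sum_k f2 j k (U th z) * tau j k z.1)).
  by apply: integrable_sum_fin => j; apply: integrable_sum_fin => k; exact: it2.
have iSy y : P.-integrable [set: T]
    (EFin \o (fun x => \sum_j \sum_k f2 j k (U th (x, y)) * tau j k x)).
  by apply: integrable_sum_fin => j; apply: integrable_sum_fin => k; exact: i2.
rewrite -(RintegralZl _ measurableT iS) !Rintegral_prod21.
- apply: eq_Rintegral => y _ /=.
  rewrite Rintegral_sum; last exact: i1.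
  rewrite (RintegralZl _ measurableT (iSy y)).
  rewrite Rintegral_sum; last by move=> j; apply: integrable_sum_fin => k; exact: i2.
  transitivity (cos th * \sum_j \sum_k
      \int[P]_x (f2 j k (U th (x, y)) * tau j k x)).
    exact: (stein (fun k => sin th * Y k y - eta k) c0).
  congr (_ * _); apply: eq_bigr => j _.
  by rewrite Rintegral_sum//; exact: i2.
- exact: (integrableZl measurableT (cos th) iS).
- by move=> y; exact: (integrableZl measurableT (cos th) (iSy y)).
- by apply: integrable_sum_fin => k; exact: iv1.
- by move=> y; apply: integrable_sum_fin => k; exact: i1.
Qed.

(** The mirror image, with V frozen and Gaussian integration by parts in Y; sine and cosine exchange
    roles. *)
Let gaussian_term th :
  \int[mu]_z (\sum_k f1 k (U th z) * Y k z.2) =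
  sin th * \int[mu]_z (\sum_j \sum_k f2 j k (U th z) * rho j k).
Proof.
have i1 x k : P'.-integrable [set: T'] (fun y => (f1 k (U th (x, y)) * Y k y)%:E).
  under eq_fun do rewrite mulrC.
  exact: (integrableM_bounded (integrable_linear_image a HX k)
    (pair_measurable th x (@mf1 k)) (fun y => f1C k _)).
have i2 x j k : P'.-integrable [set: T'] (fun y => (f2 j k (U th (x, y)) * rho j k)%:E).
  apply: (@integrable_bounded _ _ _ _ _ (C2 * `|rho j k|)).
    by apply: measurable_funM => //; exact: pair_measurable.
  by move=> y; rewrite normrM ler_wpM2r.
have iS : mu.-integrable [set: T * T']
    (EFin \o (fun z => \sum_j \sum_k f2 j k (U th z) * rho j k)).
  by apply: integrable_sum_fin => j; apply: integrable_sum_fin => k; exact: ir2.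
have iSx x : P'.-integrable [set: T']
    (EFin \o (fun y => \sum_j \sum_k f2 j k (U th (x, y)) * rho j k)).
  by apply: integrable_sum_fin => j; apply: integrable_sum_fin => k; exact: i2.
rewrite -(RintegralZl _ measurableT iS) !Rintegral_prod12.
- apply: eq_Rintegral => x _ /=.
  rewrite Rintegral_sum; last exact: i1.
  rewrite (RintegralZl _ measurableT (iSx x)).
  rewrite Rintegral_sum; last by move=> j; apply: integrable_sum_fin => k; exact: i2.
  rewrite big_distrr/=; apply: eq_bigr => j _.
  have -> : \int[P']_y (f1 j (U th (x, y)) * Y j y) = \int[P']_y (Y j y *
      f1 j (fun k => sin th * Y k y + (cos th * v k x - eta k))).
    by apply: eq_Rintegral => y _; rewrite UE mulrC.
  rewrite (linear_image_integration_by_parts a HX (C := C1 + C2) (sin th) _ j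
    (has_grad_test_grad p_gt0 beta_gt0 delta_gt0 j) (@mf1 j) (@mf2 j)).
  + congr (_ * _); rewrite Rintegral_sum; last exact: i2.
    apply: eq_bigr => k _.
    have i3 : P'.-integrable [set: T'] (EFin \o (fun y => f2 j k (U th (x, y)))).
      apply: (@integrable_bounded _ _ _ _ _ C2) => //; exact: pair_measurable.
    transitivity (rho j k * \int[P']_y f2 j k (U th (x, y))).
      apply: (congr1 (fun t => rho j k * t)).
      by apply: eq_Rintegral => y _; rewrite UE.
    by rewrite mulrC; exact/esym/(RintegralZr _ measurableT i3).
  + by move=> k; exact: coord_continuous_test_hess.
  + by move=> u; rewrite (le_trans (f1C j u))// lerDl.
  + by move=> k u; rewrite (le_trans (f2C j k u))// lerDr divr_ge0// ltW.
- exact: (integrableZl measurableT (sin th) iS).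
- by move=> x; exact: (integrableZl measurableT (sin th) (iSx x)).
- by apply: integrable_sum_fin => k; exact: iY1.
- by move=> x; apply: integrable_sum_fin => k; exact: i1.
Qed.

Let l : R := Num.sqrt (ln p%:R).
(** C2 comes from the Hessian, 4 from passing to [mean_bump], and the last factor is the
    anti-concentration bound without its 1 / s. *)
Let K : R := C2 * 4 * (delta * (6 * pi * l)).

(* After Stein's identity and Gaussian integration by parts only [tau - rho]
   survives; anti-concentration at scale [sin th] costs a factor [1 / sin th],
   which is compensated by the factor [sin th * cos th] of the derivative. *)
Let derivative_bound th : 0 < th < pi / 2 ->
  `|\int[mu]_z G th z| <= K * \int[P]_w D w.
Proof.
move=> /andP[th0 thpi].
have s0 : 0 < sin th by apply: sin_gt0_pihalf; rewrite th0 thpi.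
have c0 : 0 < cos th by apply: cos_gt0_pihalf; rewrite thpi andbT; lra.
have iS1 : mu.-integrable [set: T * T'] (fun z => (\sum_k f1 k (U th z) * v k z.1)%:E).
  by apply: integrable_sum_fin => k; exact: iv1.
have iS2 : mu.-integrable [set: T * T'] (fun z => (\sum_k f1 k (U th z) * Y k z.2)%:E).
  by apply: integrable_sum_fin => k; exact: iY1.
have iS3 : mu.-integrable [set: T * T']
    (fun z => (\sum_j \sum_k f2 j k (U th z) * tau j k z.1)%:E).
  by apply: integrable_sum_fin => j; apply: integrable_sum_fin => k; exact: it2.
have iS4 : mu.-integrable [set: T * T']
    (fun z => (\sum_j \sum_k f2 j k (U th z) * rho j k)%:E).
  by apply: integrable_sum_fin => j; apply: integrable_sum_fin => k; exact: ir2.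
pose E z := \sum_j \sum_k f2 j k (U th z) * (tau j k z.1 - rho j k).
have EE z : E z = (\sum_j \sum_k f2 j k (U th z) * tau j k z.1) -
    (\sum_j \sum_k f2 j k (U th z) * rho j k).
  rewrite -sumrB; apply: eq_bigr => j _; rewrite -sumrB; apply: eq_bigr => k _.
  by rewrite mulrBr.
have iE : mu.-integrable [set: T * T'] (EFin \o E).
  rewrite (_ : EFin \o E = fun z => (\sum_j \sum_k f2 j k (U th z) * tau j k z.1)%:E -
    (\sum_j \sum_k f2 j k (U th z) * rho j k)%:E)%E.
    exact: (integrableB measurableT iS3 iS4).
  by apply/funext => z; rewrite /= EE.
(* The V-part carries - sin th and gains cos th, the Y-part carries cos th and gains sin th: equal
   coefficients of opposite sign, so the two matrices are subtracted. *)
have -> : \int[mu]_z G th z = - (sin th * cos th) * \int[mu]_z E z.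
  transitivity (\int[mu]_z (- sin th * (\sum_k f1 k (U th z) * v k z.1) +
      cos th * (\sum_k f1 k (U th z) * Y k z.2))).
    apply: eq_Rintegral => z _; rewrite /G !big_distrr/= -big_split/=.
    by apply: eq_bigr => k _; ring.
  rewrite RintegralD//; last 2 first.
  - exact: (integrableZl measurableT (- sin th) iS1).
  - exact: (integrableZl measurableT (cos th) iS2).
  rewrite (RintegralZl _ measurableT iS1) (RintegralZl _ measurableT iS2).
  rewrite stein_term ?gt_eqF// gaussian_term.
  under [X in _ = _ * X]eq_Rintegral do rewrite EE.
  by rewrite RintegralB//; ring.
rewrite normrM normrN (gtr0_norm (mulr_gt0 s0 c0)).
have mb th' : measurable_fun [set: T * T'] (fun z => mean_bump beta delta (U th' z)).
  exact: (coord_measurable_mean_bump delta p_gt0 beta_gt0 (mU th')).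
have mbb th' z : `|mean_bump beta delta (U th' z)| <= 1.
  by have /andP[m0 m1] := mean_bump_bounds beta delta p_gt0 (U th' z); rewrite ger0_norm.
have C24 : 0 <= C2 * 4 by rewrite mulr_ge0.
(* D depends on V alone; conditionally on V, only the bump has to be averaged over Y. *)
pose H z := D z.1 * (C2 * 4 * mean_bump beta delta (U th z)).
have iH : mu.-integrable [set: T * T'] (EFin \o H).
  apply: (integrableM_bounded (integrable_fst P' iD) (C := C2 * 4)).
    exact: measurable_funM.
  by move=> z; rewrite normrM (ger0_norm C24) -[leRHS]mulr1 ler_wpM2l.
have iHx x : P'.-integrable [set: T'] (fun y => (H (x, y))%:E).
  apply: (@integrable_bounded _ _ _ _ _ (`|D x| * (C2 * 4))).
    rewrite /H /=; apply: measurable_funM; first exact: measurable_cst.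
    apply: measurable_funM; first exact: measurable_cst.
    by apply: pair_measurable; exact: coord_measurable_mean_bump.
  move=> y; rewrite normrM ler_wpM2l// normrM (ger0_norm C24).
  by rewrite -[leRHS]mulr1 ler_wpM2l.
have D0 w : 0 <= D w.
  exact: le_trans (normr_ge0 _) (tauD (Ordinal p_gt0) (Ordinal p_gt0) w).
have EH : `|\int[mu]_z E z| <= \int[mu]_z H z.
  apply: (le_trans (le_normr_Rintegral measurableT iE)).
  apply: le_Rintegral => //; first exact: integrable_norm.
  move=> z _; rewrite /E /H.
  apply: (@le_trans _ _ (\sum_j \sum_k `|f2 j k (U th z)| * D z.1)).
    apply: (le_trans (ler_norm_sum _ _ _)); apply: ler_sum => j _.
    apply: (le_trans (ler_norm_sum _ _ _)); apply: ler_sum => k _.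
    by rewrite normrM ler_wpM2l.
  under eq_bigr do rewrite -big_distrl/=.
  rewrite -big_distrl/= mulrC ler_wpM2l//.
  apply: (le_trans (sum_normr_test_hess_le p_gt0 beta_gt0 delta_gt0 _)).
  rewrite -/C2 -mulrA ler_wpM2l//.
  exact: cauchy_bump_softmax_le.
have HK : \int[mu]_z H z <= K / sin th * \int[P]_w D w.
  rewrite Rintegral_prod12// -(RintegralZl _ measurableT iD).
  have HE x : \int[P']_y H (x, y) = D x * (C2 * 4) *
      \int[P']_y mean_bump beta delta (U th (x, y)).
    rewrite -RintegralZl//; last first.
      apply: (@integrable_bounded _ _ _ _ _ 1) => //.
      by apply: pair_measurable; exact: coord_measurable_mean_bump.
    by apply: eq_Rintegral => y _; rewrite /H mulrA.
  apply: le_Rintegral => //.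
  - have := integrable_fubini_F iH; apply: eq_integrable => // x _.
    by rewrite /fubini_F /= fineK// integrable_fin_num.
  - exact: (integrableZl measurableT (K / sin th) iD).
  move=> x _; rewrite HE.
  have AC := anti_concentration HX p_ge2 gram1 (fun k => cos th * v k x - eta k) beta_gt0 delta_gt0 s0.
  have -> : \int[P']_y mean_bump beta delta (U th (x, y)) = \int[P']_y
      mean_bump beta delta (fun k => sin th * Y k y + (cos th * v k x - eta k)).
    by apply: eq_Rintegral => y _; rewrite UE.
  apply: (le_trans (ler_wpM2l _ AC)); first by rewrite mulr_ge0.
  rewrite /K le_eqVlt; apply/orP; left; apply/eqP; rewrite -/l.
  by field; rewrite gt_eqF.
have ID0 : 0 <= \int[P]_w D w by apply: Rintegral_ge0.
have l0 : 0 <= l by exact: sqrtr_ge0.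
have K0 : 0 <= K.
  rewrite /K mulr_ge0// ?mulr_ge0 ?(ltW delta_gt0) ?pi_ge0//.
apply: (@le_trans _ _ (sin th * cos th * (K / sin th * \int[P]_w D w))).
  by rewrite ler_wpM2l ?mulr_ge0 ?(ltW s0) ?(ltW c0)// (le_trans EH).
rewrite (_ : _ * _ = cos th * (K * \int[P]_w D w)); last by field; rewrite gt_eqF.
by rewrite ler_piMl ?cos_le1// mulr_ge0.
Qed.

(** As the derivative bound is uniform on the open interval of angles, the mean value theorem takes
    the place of an integral in th. The length pi / 2 is rounded up to pi. *)
Lemma interpolation_bound :
  `|\int[P]_w f (fun k => v k w - eta k) - \int[P']_w f (fun k => Y k w - eta k)| <=
  K * \int[P]_w D w * pi.
Proof.
have cPsi : continuous Psi.
  by move=> th; apply/differentiable_continuous/derivable1_diffP; case: (derPsi th).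
have pi2 : 0 < pi / 2 :> R by rewrite divr_gt0// pi_gt0.
have [th thI E] := @MVT R Psi (fun th => \int[mu]_z G th z) 0 (pi / 2) pi2
  (fun th _ => derPsi th) (continuous_subspaceT cPsi).
have E0 : Psi 0 = \int[P]_w f (fun k => v k w - eta k).
  rewrite /Psi Rintegral_prod12//.
  - apply: eq_Rintegral => w _ /=.
    transitivity (\int[P']_y f (fun k => v k w - eta k)).
      apply: eq_Rintegral => y _; congr (test_fun _ _ _); apply/funext => k.
      by rewrite /U /= cos0 sin0; ring.
    rewrite Rintegral_cst// (_ : fine _ = 1) ?mulr1//.
    by rewrite /= probability_setT.
  - exact: if_.
  - move=> x; apply: (@integrable_bounded _ _ _ _ _ 1).
      by apply: pair_measurable; exact: coord_measurable_test_fun.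
    move=> y; have /andP[f0' f1'] := test_fun_bounds beta delta (U 0 (x, y)).
    by rewrite ger0_norm.
have E1 : Psi (pi / 2) = \int[P']_w f (fun k => Y k w - eta k).
  rewrite /Psi Rintegral_prod21//.
  - apply: eq_Rintegral => w _ /=.
    transitivity (\int[P]_y f (fun k => Y k w - eta k)).
      apply: eq_Rintegral => y _; congr (test_fun _ _ _); apply/funext => k.
      by rewrite /U /= cos_pihalf sin_pihalf; ring.
    rewrite Rintegral_cst// (_ : fine _ = 1) ?mulr1//.
    by rewrite /= probability_setT.
  - exact: if_.
  - move=> x; apply: (@integrable_bounded _ _ _ _ _ 1).
      by apply: pair_measurable'; exact: coord_measurable_test_fun.
    move=> y; have /andP[f0' f1'] := test_fun_bounds beta delta (U (pi / 2) (y, x)).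
    by rewrite ger0_norm.
rewrite -E0 -E1 distrC E subr0 normrM (gtr0_norm pi2).
move: thI; rewrite in_itv/= => thI.
have B := derivative_bound thI.
apply: (le_trans (ler_wpM2r (ltW pi2) B)).
rewrite ler_wpM2l ?(le_trans (normr_ge0 _) B)//.
by rewrite ler_pdivrMr// ler_peMr ?pi_ge0// ler1n.
Qed.

End interpolation.

(** * Smoothing of orthants *)

Section smoothing.
Variables (R : realType) (p : nat) (beta delta : R).
Hypotheses (p_gt0 : (0 < p)%N) (beta_gt0 : 0 < beta) (delta_gt0 : 0 < delta).
Hypothesis beta_delta : beta * delta = ln p%:R.
Implicit Types u : 'I_p -> R.

Local Notation F := (@softmax R p beta).
Local Notation f := (@test_fun R p beta delta).

Definition orthant_indicator u : R := if [forall k, u k <= 0] then 1 else 0.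

Let ln_div : ln p%:R / beta = delta.
Proof. by rewrite -beta_delta mulrC mulKf// gt_eqF. Qed.

Let softmax_le_delta u : (forall k, u k <= 0) -> F u <= delta.
Proof. by move=> /(softmax_le p_gt0 beta_gt0); rewrite ln_div add0r. Qed.

Let softmax_gt0 u : ~~ [forall k, u k <= 0] -> 0 < F u.
Proof.
rewrite negb_forall => /existsP[k]; rewrite -ltNge => uk.
exact: lt_le_trans uk (le_softmax p_gt0 beta_gt0 u k).
Qed.

(** The window contains both error regions of the smoothing, 0 < F < 4 delta outside the orthant and
    - 3 delta < F <= delta inside. There 1 + (F / delta)^2 <= 1 + 4^2 = 17, and 68 = 4 * 17. *)
Let bump_ge u : - (3 * delta) < F u -> F u < 4 * delta ->
  1 <= 68 * mean_bump beta delta u.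
Proof.
move=> F1 F2; have := cauchy_bump_softmax_le p_gt0 beta_gt0 delta_gt0 u beta_delta.
suff : 1 <= 17 * cauchy_bump (F u / delta) by lra.
rewrite /cauchy_bump -lock ler_pdivlMr; last by have := sqr_ge0 (F u / delta); lra.
have h1 : - 3 < F u / delta by rewrite ltr_pdivlMr// mulNr.
have h2 : F u / delta < 4 by rewrite ltr_pdivrMr.
nra.
Qed.

Let mean_bump_ge0 u : 0 <= 68 * mean_bump beta delta u.
Proof. by have /andP[? _] := mean_bump_bounds beta delta p_gt0 u; rewrite mulr_ge0. Qed.

Let f01 u : 0 <= f u <= 1.
Proof. exact: test_fun_bounds. Qed.

(** The outer approximation: on the orthant the soft maximum can reach delta, so the step starts
    there. *)
Lemma orthant_le_test_fun u :
  orthant_indicator u <= f (fun k => u k - delta).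
Proof.
rewrite /orthant_indicator; case: ifPn => [/forallP u0|_]; last first.
  by have /andP[] := f01 (fun k => u k - delta).
rewrite test_fun_eq1// softmax_shift// subr_le0.
exact: softmax_le_delta.
Qed.

Lemma test_fun_le_orthant u :
  f (fun k => u k - delta) <= orthant_indicator u + 68 * mean_bump beta delta u.
Proof.
rewrite /orthant_indicator; have /andP[f0 f1] := f01 (fun k => u k - delta).
have b0 := mean_bump_ge0 u.
case: ifPn => [_|/softmax_gt0 F0]; first by rewrite (le_trans f1)// lerDl.
rewrite add0r; have [F4|F4] := leP (4 * delta) (F u).
  by rewrite test_fun_eq0// softmax_shift//; lra.
by rewrite (le_trans f1)// bump_ge//; lra.
Qed.

(** The inner approximation: the step has width 3 delta and must have dropped to 0 once F is
    positive, as it is off the orthant. *)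
Lemma test_fun_shift_le_orthant u :
  f (fun k => u k - (- (3 * delta))) <= orthant_indicator u.
Proof.
rewrite /orthant_indicator; case: ifPn => [_|/softmax_gt0 F0].
  by have /andP[] := f01 (fun k => u k - (- (3 * delta))).
by rewrite test_fun_eq0// softmax_shift//; lra.
Qed.

Lemma orthant_le_test_fun_shift u : orthant_indicator u <=
  f (fun k => u k - (- (3 * delta))) + 68 * mean_bump beta delta u.
Proof.
rewrite /orthant_indicator.
have /andP[f0 f1] := f01 (fun k => u k - (- (3 * delta))).
have b0 := mean_bump_ge0 u.
case: ifPn => [/forallP u0|_]; last by rewrite addr_ge0.
have F1 := softmax_le_delta u0.
have [F3|F3] := leP (F u) (- (3 * delta)).
  rewrite test_fun_eq1 ?lerDl// softmax_shift//; lra.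
by rewrite ler_wpDl// bump_ge//; lra.
Qed.

End smoothing.

Section lower_orthant.
Context (R : realType) d (T : measurableType d) (p : nat) (U : 'I_p -> T -> R).
Hypothesis mU : forall k, measurable_fun [set: T] (U k).
Local Notation S := [set w | forall k, U k w <= 0].

Lemma measurable_lower_orthant : measurable S.
Proof.
rewrite (_ : S = \bigcap_(k in [set: 'I_p]) (U k @^-1` `]-oo, 0])).
  apply: fin_bigcap_measurable => // k _.
  by rewrite -[X in measurable X]setTI; exact: mU.
apply/seteqP; split => w /= H k; first by move=> _; rewrite /= in_itv/=.
by have /= := H k I; rewrite in_itv.
Qed.

Lemma orthant_indicatorE : (fun w => orthant_indicator (U ^~ w)) = \1_S.
Proof.
apply/funext => w; rewrite indicE /orthant_indicator.
case: ifPn => [/forallP H|H]; first by rewrite mem_set.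
by rewrite memNset// => Hw; move/negP: H; apply; apply/forallP.
Qed.

Lemma measurable_orthant_indicator :
  measurable_fun [set: T] (fun w => orthant_indicator (U ^~ w)).
Proof.
by rewrite orthant_indicatorE; exact/measurable_indic/measurable_lower_orthant.
Qed.

Lemma probability_lower_orthant (P : probability T R) :
  P S = (\int[P]_w orthant_indicator (U ^~ w))%:E.
Proof.
rewrite orthant_indicatorE /Rintegral integral_indic//; last first.
  exact: measurable_lower_orthant.
by rewrite setIT fineK// fin_num_measure//; exact: measurable_lower_orthant.
Qed.

End lower_orthant.

(** The error B is attached to y only, which will be the Gaussian probability; x is compared with
    the smoothed quantities without loss. *)
Lemma sandwich (R : realDomainType) (x y x1 y1 x2 y2 K B : R) :
  `|x1 - y1| <= K -> `|x2 - y2| <= K -> x <= x1 -> y1 <= y + B ->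
  x2 <= x -> y <= y2 + B -> `|x - y| <= K + B.
Proof.
rewrite !ler_norml => /andP[? ?] /andP[? ?] ? ? ? ?.
by apply/andP; split; lra.
Qed.

Section orthant_distance.
Context (R : realType) d (T : measurableType d) (P : probability T R)
  d' (T' : measurableType d') (P' : probability T' R).
Variables (m p : nat) (X : 'I_m -> T' -> R) (a : 'I_m -> 'I_p -> R).
Hypotheses (HX : std_normal_family P' X) (p_ge2 : (2 <= p)%N).
Hypothesis gram1 : forall j, gram a j j = 1.
Variables (v : 'I_p -> T -> R) (tau : 'I_p -> 'I_p -> T -> R) (D : T -> R).
Hypotheses (iv : forall j, P.-integrable [set: T] (EFin \o v j))
  (mtau : forall j k, measurable_fun [set: T] (tau j k))
  (iD : P.-integrable [set: T] (EFin \o D))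
  (tauD : forall j k w, `|tau j k w - gram a j k| <= D w).
Local Notation Y := (linear_image X a).
Hypothesis stein : forall (beta delta : R), 0 < beta -> 0 < delta ->
  forall (c : R) (b : 'I_p -> R), c != 0 ->
  \sum_j \int[P]_w (test_grad beta delta j (fun k => c * v k w + b k) * v j w) =
  c * \sum_j \sum_k \int[P]_w (test_hess beta delta j k (fun k => c * v k w + b k) * tau j k w).

Lemma orthant_distance_le (eta : 'I_p -> R) (delta : R) : 0 < delta ->
  `|\int[P]_w orthant_indicator (fun k => v k w - eta k) -
    \int[P']_w orthant_indicator (fun k => Y k w - eta k)| <=
  (960 * pi ^+ 2 * \int[P]_w D w) * (Num.sqrt (ln p%:R) ^+ 3 / delta) +
  408 * pi * (Num.sqrt (ln p%:R) * delta).
Proof.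
move=> delta0; have p_gt0 : (0 < p)%N by exact: leq_trans p_ge2.
(* With this choice the error of the soft maximum matches the width scale of the step. *)
pose beta := ln p%:R / delta : R.
have l_ge := ln_dim_ge R p_ge2; have l0 := sqrt_ln_dim_gt0 R p_ge2.
have l2 := sqr_sqrt_ln_dim R p_ge2.
have beta0 : 0 < beta by rewrite divr_gt0//; lra.
have bd : beta * delta = ln p%:R by rewrite divfK// gt_eqF.
set l := Num.sqrt _ in l0 l2 *.
(* 408 = 68 * 6, from [bump_ge] and from anti-concentration with s = 1. *)
pose B := 408 * pi * (l * delta).
pose K := 10 * (delta^-1 ^+ 2 + 2 * beta / delta) * 4 * (delta * (6 * pi * l)).
have IB (eta' : 'I_p -> R) : `|\int[P]_w test_fun beta delta (fun k => v k w - eta' k) -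
    \int[P']_w test_fun beta delta (fun k => Y k w - eta' k)| <=
    K * \int[P]_w D w * pi.
  exact: (interpolation_bound HX p_ge2 gram1 iv mtau iD tauD beta0 delta0 bd (stein beta0 delta0)).
have mv k : measurable_fun [set: T] (v k).
  by apply/measurable_EFinP; exact: measurable_int (iv k).
have mY k : measurable_fun [set: T'] (Y k) by exact: (measurable_linear_image a HX).
have D0 : 0 <= \int[P]_w D w.
  apply: Rintegral_ge0 => w _.
  exact: le_trans (normr_ge0 _) (tauD (Ordinal p_gt0) (Ordinal p_gt0) w).
(* Since beta = l^2 / delta, K equals 240 pi l (1 + 2 l^2) / delta; then 1 <= 2 l^2 turns the
   bracket into 4 l^2 and yields 960. *)
have KB : K * \int[P]_w D w * pi <= (960 * pi ^+ 2 * \int[P]_w D w) * (l ^+ 3 / delta).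
  rewrite (_ : (960 * pi ^+ 2 * \int[P]_w D w) * (l ^+ 3 / delta) =
    (960 * pi * (l ^+ 3 / delta)) * \int[P]_w D w * pi); last by ring.
  rewrite ler_wpM2r ?pi_ge0// ler_wpM2r//.
  rewrite /K (_ : _ * (6 * pi * l) = delta * 6 * pi * l); last by ring.
  rewrite /beta -l2.
  rewrite (_ : 10 * (delta^-1 ^+ 2 + 2 * (l ^+ 2 / delta) / delta) * 4 *
     (delta * 6 * pi * l) = 240 * pi * (l * (1 + 2 * l ^+ 2) / delta)); last first.
    by field; rewrite gt_eqF.
  rewrite (_ : 960 * pi * (l ^+ 3 / delta) = 240 * pi * (l * (4 * l ^+ 2) / delta)); last by ring.
  apply: ler_wpM2l; first by apply: mulr_ge0; [exact: ler0n|exact: pi_ge0].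
  apply: ler_wpM2r; first by rewrite invr_ge0 ltW.
  by rewrite ler_wpM2l ?(ltW l0)// l2; lra.
have AC : \int[P']_w mean_bump beta delta (fun k => 1 * Y k w + - eta k) <= delta / 1 * (6 * pi * l).
  exact: (anti_concentration HX p_ge2 gram1 _ beta0 delta0 ltr01).
have iI d1 (T1 : measurableType d1) (P1 : probability T1 R) (u : 'I_p -> T1 -> R) :
    (forall k, measurable_fun [set: T1] (u k)) ->
    P1.-integrable [set: T1] (EFin \o (fun w => orthant_indicator (fun k => u k w - eta k))).
  move=> mu; apply: (@integrable_bounded _ _ _ _ _ 1).
    apply: (measurable_orthant_indicator (U := fun k w => u k w - eta k)) => k.
    exact: measurable_funB.
  by move=> w; rewrite /orthant_indicator; case: ifP; rewrite ?normr1 ?normr0.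
have iF d1 (T1 : measurableType d1) (P1 : probability T1 R) (u : 'I_p -> T1 -> R) (eta' : 'I_p -> R) :
    (forall k, measurable_fun [set: T1] (u k)) ->
    P1.-integrable [set: T1] (EFin \o (fun w => test_fun beta delta (fun k => u k w - eta' k))).
  move=> mu; apply: (@integrable_bounded _ _ _ _ _ 1).
    apply: (coord_measurable_test_fun beta delta (X := fun k w => u k w - eta' k)) => k.
    exact: measurable_funB.
  by move=> w; have /andP[f0 f1] := test_fun_bounds beta delta (fun k => u k w - eta' k); rewrite ger0_norm.
have iM : P'.-integrable [set: T']
    (EFin \o (fun w => mean_bump beta delta (fun k => Y k w - eta k))).
  apply: (@integrable_bounded _ _ _ _ _ 1).
    apply: (coord_measurable_mean_bump delta p_gt0 beta0 (X := fun k w => Y k w - eta k)) => k.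
    exact: measurable_funB.
  by move=> w; have /andP[f0 f1] := mean_bump_bounds beta delta p_gt0 (fun k => Y k w - eta k); rewrite ger0_norm.
have EM : 68 * \int[P']_w mean_bump beta delta (fun k => Y k w - eta k) <= B.
  have -> : \int[P']_w mean_bump beta delta (fun k => Y k w - eta k) =
      \int[P']_w mean_bump beta delta (fun k => 1 * Y k w + - eta k).
    by apply: eq_Rintegral => w _; congr mean_bump; apply/funext => k; rewrite mul1r.
  rewrite (_ : B = 68 * (delta / 1 * (6 * pi * l))); last by rewrite /B; field.
  by rewrite ler_pM2l.
have shift d1 (T1 : measurableType d1) (P1 : probability T1 R) (u : 'I_p -> T1 -> R) (r : R) :
    \int[P1]_w test_fun beta delta (fun k => u k w - (eta k + r)) =
    \int[P1]_w test_fun beta delta (fun k => u k w - eta k - r).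
  by apply: eq_Rintegral => w _; congr test_fun; apply/funext => k; rewrite opprD addrA.
have IBr r : `|\int[P]_w test_fun beta delta (fun k => v k w - eta k - r) -
    \int[P']_w test_fun beta delta (fun k => Y k w - eta k - r)| <=
    K * \int[P]_w D w * pi.
  by rewrite -(shift _ _ P v r) -(shift _ _ P' Y r); exact: IB.
have iF' d1 (T1 : measurableType d1) (P1 : probability T1 R) (u : 'I_p -> T1 -> R) r :
    (forall k, measurable_fun [set: T1] (u k)) ->
    P1.-integrable [set: T1] (EFin \o (fun w => test_fun beta delta (fun k => u k w - eta k - r))).
  move=> mu; have := iF _ _ P1 u (fun k => eta k + r) mu.
  apply: eq_integrable => // w _ /=; congr (test_fun _ _ _)%:E.
  by apply/funext => k; rewrite opprD addrA.
set pV := \int[P]_w _; set pY := \int[P']_w _.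
have U1 : pV <= \int[P]_w test_fun beta delta (fun k => v k w - eta k - delta).
  apply: le_Rintegral => //; [exact: iI|exact: iF'|].
  by move=> w _; exact: orthant_le_test_fun.
have U2 : \int[P']_w test_fun beta delta (fun k => Y k w - eta k - delta) <= pY + B.
  apply: (@le_trans _ _ (\int[P']_w (orthant_indicator (fun k => Y k w - eta k) +
     68 * mean_bump beta delta (fun k => Y k w - eta k)))).
    apply: le_Rintegral => //; first exact: iF'.
      exact: (integrableD measurableT (iI _ _ P' Y mY) (integrableZl measurableT 68 iM)).
    by move=> w _; exact: test_fun_le_orthant.
  rewrite RintegralD//; [|exact: iI|exact: (integrableZl measurableT 68 iM)].
  by rewrite (RintegralZl _ measurableT iM) lerD2l.
have L1 : \int[P]_w test_fun beta delta (fun k => v k w - eta k - - (3 * delta)) <= pV.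
  apply: le_Rintegral => //; [exact: iF'|exact: iI|].
  by move=> w _; exact: test_fun_shift_le_orthant.
have L2 : pY <= \int[P']_w test_fun beta delta (fun k => Y k w - eta k - - (3 * delta)) + B.
  apply: (@le_trans _ _ (\int[P']_w (test_fun beta delta (fun k => Y k w - eta k - - (3 * delta)) +
     68 * mean_bump beta delta (fun k => Y k w - eta k)))).
    apply: le_Rintegral => //; first exact: iI.
      exact: (integrableD measurableT (iF' _ _ P' Y _ mY) (integrableZl measurableT 68 iM)).
    by move=> w _; exact: orthant_le_test_fun_shift.
  rewrite RintegralD//; [|exact: iF'|exact: (integrableZl measurableT 68 iM)].
  by rewrite (RintegralZl _ measurableT iM) lerD2l.
apply: le_trans (lerD KB (lexx B)).
exact: sandwich (IBr delta) (IBr (- (3 * delta))) U1 U2 L1 L2.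
Qed.

End orthant_distance.

(** * Stein kernels and Gaussian vectors *)

Section directional_derivatives.
Context (R : realType) (p : nat).
Implicit Types (x : 'rV[R]_p) (lam b : 'I_p -> R).

(** The two difference quotients are the same function. This links directional derivatives on row
    vectors to the curve-based [has_grad]. *)
Lemma is_derive_line x (v : 'rV[R]_p) (g : 'rV[R]_p -> R) (l : R) :
  is_derive (0 : R) 1 (fun t => g (t *: v + x)) l -> is_derive x v g l.
Proof.
have E : (fun h : R => h^-1 *: ((g \o shift x) (h *: v) - g x)) =
    (fun h : R => h^-1 *: (((fun t => g (t *: v + x)) \o shift 0) (h *: 1) - g (0 *: v + x))).
  by apply/funext => h; rewrite /= addr0 [h *: 1]mulr1 scale0r add0r.
move=> [d1 d2]; apply: DeriveDef; first by rewrite /derivable E.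
by rewrite /derive E.
Qed.

Definition affine_coord lam b x (k : 'I_p) : R := lam k * x ord0 k + b k.

Lemma is_derive_affine_coord (h : ('I_p -> R) -> R) dh lam b j x :
  has_grad h dh ->
  is_derive x (delta_mx ord0 j : 'rV[R]_p) (fun x => h (affine_coord lam b x))
    (lam j * dh j (affine_coord lam b x)).
Proof.
move=> gh; apply: is_derive_line.
pose U (k : 'I_p) (t : R) := affine_coord lam b (t *: delta_mx ord0 j + x) k.
have dU k : is_derive (0 : R) 1 (U k) (lam k * (k == j)%:R).
  rewrite (_ : U k = fun t => lam k * (k == j)%:R * t + affine_coord lam b x k).
    exact: is_derive_affine_pt.
  apply/funext => t; rewrite /U /affine_coord !mxE eqxx /=; ring.
apply: is_derive_eq (gh U _ 0 dU) _.
rewrite (bigD1 j)//= eqxx mulr1 big1 ?addr0.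
  rewrite mulrC; congr (_ * dh _ _); apply/funext => k.
  by rewrite /U scale0r add0r.
by move=> k /negbTE ->; rewrite !mulr0.
Qed.

Lemma continuous_affine_coord lam b k : continuous (fun x => affine_coord lam b x k).
Proof.
move=> x; apply: (@continuous_comp _ _ _ (fun x : 'rV[R]_p => x ord0 k)
  (fun t : R => lam k * t + b k)); first exact: coord_continuous.
apply/differentiable_continuous/derivable1_diffP.
by case: (is_derive_affine_pt (lam k) (b k) (x ord0 k)).
Qed.

Lemma Cb_affine_coord (h : ('I_p -> R) -> R) (C : R) lam b :
  coordwise_continuous h -> (forall u, `|h u| <= C) ->
  Cb (fun x => h (affine_coord lam b x)).
Proof.
move=> ch hC; split.
  exact: (ch _ (fun k x => affine_coord lam b x k) (@continuous_affine_coord lam b)).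
exists C; split; first exact: num_real.
by move=> M CM x _ /=; rewrite (le_trans (hC _))// ltW.
Qed.

Lemma CbZ (h : 'rV[R]_p -> R) (r : R) : Cb h -> Cb (fun x => r * h x).
Proof.
move=> [ch [C [_ hC]]]; split.
  move=> x; apply: (@continuous_comp _ _ _ h (fun t : R => r * t)); first exact: ch.
  exact: mulrl_continuous.
(* [bounded_fun] gives a bound at every M > C, with C of unknown sign; |C| + 1 is such an M. *)
exists (`|r| * (`|C| + 1)); split; first exact: num_real.
move=> M CM x _ /=; rewrite normrM (le_trans _ (ltW CM))// ler_wpM2l//.
by apply: (hC (`|C| + 1)) => //; rewrite (le_lt_trans (ler_norm C))// ltrDl.
Qed.

Lemma measurable_coord_mx m n (i : 'I_m) (j : 'I_n) :
  measurable_fun [set: borelM R m n] (fun M : 'M[R]_(m, n) => M i j).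
Proof.
apply: (measurability _ (RGenOpens.measurableE R)).
move=> _ [_ [a [c ->] <-]]; rewrite setTI; apply: sub_sigma_algebra.
have /continuousP cc : continuous (fun M : 'M[R]_(m, n) => M i j) by exact: coord_continuous.
exact/cc/interval_open.
Qed.

End directional_derivatives.

Section stein_test_functions.
Context (R : realType) (p : nat) (beta delta : R).
Hypotheses (p_gt0 : (0 < p)%N) (beta_gt0 : 0 < beta) (delta_gt0 : 0 < delta).
Variables (lam b : 'I_p -> R).
Local Notation u := (affine_coord lam b).
Local Notation phi := (fun x => test_fun beta delta (u x)).

(** Differentiating the k-th gradient component along j produces [test_hess k j]; symmetry restores
    the index order of the kernel. *)
Lemma test_hessC j k (v : 'I_p -> R) :
  test_hess beta delta j k v = test_hess beta delta k j v.
Proof.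
rewrite /test_hess [_ * softmax_weight beta k v]mulrC; congr (_ + _ * _).
rewrite -!mulrA; congr (_ * _); rewrite !mulrBr eq_sym.
by case: eqP => [->//|_]; rewrite !mulr0 mulrC.
Qed.

Lemma partial_test_fun j :
  partial j phi = fun x => lam j * test_grad beta delta j (u x).
Proof.
apply/funext => x; apply: derive_val.
exact: is_derive_affine_coord (has_grad_test_fun delta p_gt0 beta_gt0).
Qed.

Lemma is_derive_partial_test_fun j k x :
  is_derive x (delta_mx ord0 j : 'rV[R]_p)
    (fun x => lam k * test_grad beta delta k (u x))
    (lam j * (lam k * test_hess beta delta j k (u x))).
Proof.
rewrite test_hessC.
exact: (is_derive_affine_coord lam b j x
  (has_gradZ (lam k) (has_grad_test_grad p_gt0 beta_gt0 delta_gt0 k))).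
Qed.

Lemma partial_partial_test_fun j k : partial j (partial k phi) =
  fun x => lam j * (lam k * test_hess beta delta j k (u x)).
Proof.
rewrite partial_test_fun; apply/funext => x; apply: derive_val.
exact: is_derive_partial_test_fun.
Qed.

Lemma Cb2_test_fun : Cb2 phi.
Proof.
split.
- apply: (@Cb_affine_coord _ _ _ 1).
    exact: coord_continuous_test_fun.
  by move=> v; have /andP[f0 f1] := test_fun_bounds beta delta v; rewrite ger0_norm.
- move=> j; rewrite partial_test_fun; split.
    move=> x; have [] // := is_derive_affine_coord lam b j x
      (has_grad_test_fun delta p_gt0 beta_gt0).
  apply: CbZ; apply: (@Cb_affine_coord _ _ _ (10 / delta)).
    exact: coord_continuous_test_grad.
  by move=> v; exact: normr_test_grad.
- move=> j k; rewrite partial_partial_test_fun partial_test_fun; split.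
    by move=> x; case: (is_derive_partial_test_fun j k x).
  apply: CbZ; apply: CbZ.
  apply: (@Cb_affine_coord _ _ _ (10 * (delta^-1 ^+ 2 + 2 * beta / delta))).
    exact: coord_continuous_test_hess.
  by move=> v; exact: test_hess_bounded.
Qed.

End stein_test_functions.

Section stein_identity.
Context (R : realType) d (T : measurableType d) (P : probability T R) (p : nat).
Variables (V : {RV P >-> borelV R p}) (tau : 'rV[R]_p -> 'M[R]_p) (beta delta : R).
Hypotheses (p_gt0 : (0 < p)%N) (beta_gt0 : 0 < beta) (delta_gt0 : 0 < delta).
Hypothesis Vtau : stein_kernel P V tau.

Lemma measurable_coord j : measurable_fun [set: T] (fun w => (V w : 'rV[R]_p) ord0 j).
Proof.
apply: (measurableT_comp (f := fun M : borelV R p => (M : 'rV[R]_p) ord0 j)) => //.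
exact: measurable_coord_mx.
Qed.

Lemma measurable_kernel_entry j k : measurable_fun [set: T] (fun w => tau (V w) j k).
Proof.
apply: (measurableT_comp (f := fun M : borelM R p p => M j k)).
  exact: measurable_coord_mx.
by apply: measurableT_comp; first exact: Vtau.1.
Qed.

(** Each partial derivative of x |-> f(c lam x + b) brings out a factor c lam_j. The lam are
    absorbed into the vector and the kernel, so that normalized coordinates inherit a Stein
    identity; of the powers c and c^2 a single c remains on the right. *)
Lemma stein_test_fun (lam : 'I_p -> R) (c : R) (b : 'I_p -> R) : c != 0 ->
  \sum_j \int[P]_w (test_grad beta delta j
     (fun k => c * (lam k * (V w : 'rV_p) ord0 k) + b k) * (lam j * (V w : 'rV_p) ord0 j)) =
  c * \sum_j \sum_k \int[P]_w (test_hess beta delta j k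
     (fun k => c * (lam k * (V w : 'rV_p) ord0 k) + b k) * (lam j * lam k * tau (V w) j k)).
Proof.
move=> c0.
have uE (x : 'rV[R]_p) : (fun k => c * (lam k * x ord0 k) + b k) =
    affine_coord (fun k => c * lam k) b x.
  by apply/funext => k; rewrite /affine_coord mulrA.
set lam' := fun k => c * lam k in uE *.
have [i1 i2] := Vtau.2 _ (Cb2_test_fun p_gt0 beta_gt0 delta_gt0 lam' b).
pose g1 j w := partial j (fun x => test_fun beta delta (affine_coord lam' b x)) (V w) *
  (V w : 'rV[R]_p) ord0 j.
pose g2 j k w := partial j (partial k
  (fun x => test_fun beta delta (affine_coord lam' b x))) (V w) * tau (V w) j k.
have E1 j : ('E_P[g1 j] = (\int[P]_w g1 j w)%:E)%E.
  by rewrite unlock /Rintegral fineK// integrable_fin_num//; exact: i1.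
have E2 j k : ('E_P[g2 j k] = (\int[P]_w g2 j k w)%:E)%E.
  by rewrite unlock /Rintegral fineK// integrable_fin_num//; exact: i2.
rewrite (eq_bigr _ (fun j _ => E1 j)).
rewrite (eq_bigr _ (fun j _ => eq_bigr _ (fun k _ => E2 j k))).
under [X in _ = X -> _]eq_bigr do rewrite sumEFin.
rewrite !sumEFin => -[E].
have G1 j : \int[P]_w (test_grad beta delta j
    (fun k => c * (lam k * (V w : 'rV_p) ord0 k) + b k) * (lam j * (V w : 'rV_p) ord0 j)) =
    c^-1 * \int[P]_w g1 j w.
  rewrite -RintegralZl//; last exact: i1.
  apply: eq_Rintegral => w _; rewrite /g1 (partial_test_fun _ p_gt0 beta_gt0) uE /lam'.
  by field.
have G2 j k : \int[P]_w (test_hess beta delta j k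
     (fun k => c * (lam k * (V w : 'rV_p) ord0 k) + b k) * (lam j * lam k * tau (V w) j k)) =
    c^-1 ^+ 2 * \int[P]_w g2 j k w.
  rewrite -RintegralZl//; last exact: i2.
  apply: eq_Rintegral => w _.
  rewrite /g2 (partial_partial_test_fun p_gt0 beta_gt0 delta_gt0) uE /lam'.
  by field.
under eq_bigr do rewrite G1.
under [in RHS]eq_bigr do under eq_bigr do rewrite G2.
under [in RHS]eq_bigr do rewrite -mulr_sumr.
by rewrite -!mulr_sumr E mulrA expr2 mulrA divff// mul1r.
Qed.

End stein_identity.

Section gaussian_vector_law.
Context (R : realType) d (T : measurableType d) (Q : probability T R)
  d' (T' : measurableType d') (P' : probability T' R) (p m : nat).
Variables (Z : {RV Q >-> borelV R p}) (N : {RV P' >-> borelV R m})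
  (A : 'M[R]_(m, p)) (b : 'rV[R]_p) (Sigma : 'M[R]_p).
Hypotheses (gN : std_gaussian P' N) (lawZ : forall B : set (borelV R p),
  measurable B -> Q [set w | B (Z w)] = P' [set w | B ((N w : 'rV[R]_m) *m A + b)]).
Hypotheses (cZ : centered Q Z) (sZ : has_covariance Q Z Sigma).

Definition vector_coord (i : 'I_m) (w : T') : R := (N w : 'rV[R]_m) ord0 i.
Local Notation X := vector_coord.
Local Notation Y := (linear_image X (fun i j => A i j)).

Lemma std_normal_family_vector_coord : std_normal_family P' X.
Proof. by split => [i|B mB]; [exact: measurable_coord|exact: gN]. Qed.
Let HX := std_normal_family_vector_coord.

Lemma affine_vector_coord w j :
  ((N w : 'rV[R]_m) *m A + b) ord0 j = Y j w + b ord0 j.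
Proof.
rewrite !mxE; congr (_ + _); rewrite /linear_image.
by apply: eq_bigr => i _; rewrite mulrC.
Qed.

Lemma expectation_gaussian_vector (g : 'rV[R]_p -> R) :
  measurable_fun [set: borelV R p] g ->
  measurable_fun [set: T'] (fun w => g ((N w : 'rV[R]_m) *m A + b)) ->
  \int[Q]_w g (Z w) = \int[P']_w g ((N w : 'rV[R]_m) *m A + b).
Proof.
move=> mg mg'; rewrite /Rintegral; congr fine.
apply: (@integral_same_law _ _ _ _ _ R _ Q P' (fun w => g (Z w)) _ _ mg' _ EFin) => //.
  exact: (measurableT_comp mg).
move=> B mB; have := lawZ (B := g @^-1` B); apply.
by rewrite -[X in measurable X]setTI; exact: mg.
Qed.

Let mcoord j : measurable_fun [set: borelV R p] (fun x : 'rV[R]_p => x ord0 j).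
Proof. exact: measurable_coord_mx. Qed.

Let mZ' j : measurable_fun [set: T']
  (fun w => ((N w : 'rV[R]_m) *m A + b) ord0 j).
Proof.
under eq_fun do rewrite affine_vector_coord.
by apply: measurable_funD => //; exact: measurable_linear_image HX j.
Qed.

(** Z and the linear image of the standard normal vector are both centered, so the translation in
    the representation must vanish. *)
Lemma gaussian_vector_mean0 j : b ord0 j = 0.
Proof.
have [iZ EZ] := cZ j.
have : \int[Q]_w (Z w : 'rV[R]_p) ord0 j = 0.
  by move: EZ; rewrite unlock /Rintegral => ->.
rewrite (expectation_gaussian_vector (mcoord j) (mZ' j)).
under eq_Rintegral do rewrite affine_vector_coord.
rewrite RintegralD//.
- rewrite (Rintegral_linear_image _ HX) add0r Rintegral_cst// (_ : fine _ = 1).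
    by rewrite mulr1.
  by rewrite /= probability_setT.
- exact: integrable_linear_image HX j.
- by apply: (@integrable_bounded _ _ _ P' _ `|b ord0 j|) => // w; rewrite normr_id.
Qed.

Lemma gaussian_vector_coord w j :
  ((N w : 'rV[R]_m) *m A + b) ord0 j = Y j w.
Proof. by rewrite affine_vector_coord gaussian_vector_mean0 addr0. Qed.

Lemma gaussian_vector_covariance j k : gram (fun i j => A i j) j k = Sigma j k.
Proof.
have := sZ j k; rewrite unlock; have [_ ->] := cZ j; have [_ ->] := cZ k.
rewrite unlock /= => E; rewrite -(Rintegral_linear_imageM _ HX).
transitivity (\int[Q]_w ((Z w : 'rV[R]_p) ord0 j * (Z w : 'rV[R]_p) ord0 k)).
  rewrite (expectation_gaussian_vector (g := fun x => x ord0 j * x ord0 k)).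
  - by under [RHS]eq_Rintegral do rewrite !gaussian_vector_coord.
  - by apply: measurable_funM.
  - by apply: measurable_funM.
rewrite /Rintegral -[RHS]/(fine (Sigma j k)%:E) -E; congr fine.
apply: eq_integral => w _.
transitivity ((((Z w : 'rV[R]_p) ord0 j - 0) * ((Z w : 'rV[R]_p) ord0 k - 0))%:E).
  by rewrite !subr0.
by [].
Qed.

Lemma orthant_gaussian_vector (y : 'rV[R]_p) :
  Q (orthant Z y) = P' [set w | forall j, Y j w <= y ord0 j].
Proof.
rewrite (_ : orthant Z y = [set w | [set x : 'rV[R]_p | forall j, x ord0 j <= y ord0 j] (Z w)])//.
rewrite lawZ.
  by congr (P' _); apply/seteqP; split => w /= H j; have := H j; rewrite gaussian_vector_coord.
rewrite (_ : [set _ | _] =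
    [set x : borelV R p | forall j, (x : 'rV[R]_p) ord0 j - y ord0 j <= 0]).
  by apply: measurable_lower_orthant => j; exact: measurable_funB.
by apply/seteqP; split => x /= H j; have := H j; rewrite subr_le0.
Qed.

End gaussian_vector_law.

(** * Optimization of the scale and the final bound *)

Lemma measurable_bigmaxr (R : realType) d (T : measurableType d) I (s : seq I)
    (f : I -> T -> R) :
  (forall i, measurable_fun [set: T] (f i)) ->
  measurable_fun [set: T] (fun w => \big[Num.max/0]_(i <- s) f i w).
Proof.
move=> mf; elim: s => [|i s IHs]; first by under eq_fun do rewrite big_nil; exact: measurable_cst.
by under eq_fun do rewrite big_cons; exact: measurable_maxr.
Qed.

(** For D > 0, delta = l sqrt D makes D l^3 / delta and l delta both equal to l^2 sqrt D. For D = 0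
    there is no optimal scale and delta has to tend to 0. *)
Lemma optimal_scale (R : realType) (A B l D x : R) : 0 <= A -> 0 <= B -> 0 < l -> 0 <= D ->
  (forall delta, 0 < delta -> x <= A * D * (l ^+ 3 / delta) + B * (l * delta)) ->
  x <= (A + B) * Num.sqrt (D * (l ^+ 2) ^+ 2).
Proof.
move=> A0 B0 l0; rewrite le_eqVlt => /orP[/eqP <-|D0] H.
  rewrite mul0r sqrtr0 mulr0 leNgt; apply/negP => x0.
  have Bl : 0 < B * l + 1 by rewrite ltr_wpDl// mulr_ge0// ltW.
  (* At this scale the bound drops below x / 2, contradicting x > 0; the added 1 guards against B =
     0. *)
  have := H (x / (2 * (B * l + 1))); rewrite divr_gt0 ?mulr_gt0// => /(_ isT).
  rewrite mulr0 mul0r add0r (_ : B * _ = x / 2 - x / (2 * (B * l + 1))).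
    have : 0 < x / (2 * (B * l + 1)) by rewrite divr_gt0 ?mulr_gt0.
    lra.
  by field; rewrite gt_eqF.
have s0 : 0 < Num.sqrt D by rewrite sqrtr_gt0.
apply: (le_trans (H (l * Num.sqrt D) (mulr_gt0 l0 s0))).
rewrite (sqrtrM _ (ltW D0)) sqrtr_sqr ger0_norm ?sqr_ge0//.
have Ds := sqr_sqrtr (ltW D0); set s := Num.sqrt D in s0 Ds *.
rewrite -Ds le_eqVlt; apply/orP; left; apply/eqP.
by field; rewrite !gt_eqF.
Qed.

Section kolmogorov_bound.
Context (R : realType) d (T : measurableType d) (P : probability T R) (p : nat).
Variables (c : R) (V : {RV P >-> borelV R p}) (tau : 'rV[R]_p -> 'M[R]_p).
Context d' (T' : measurableType d') (Q : probability T' R).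
Variables (Z : {RV Q >-> borelV R p}) (Sigma : 'M[R]_p).
Hypotheses (c_gt0 : 0 < c) (p_ge2 : (2 <= p)%N).
Hypotheses (cV : centered P V) (Vtau : stein_kernel P V tau).
Hypotheses (gZ : gaussian_vector Q Z) (cZ : centered Q Z).
Hypotheses (sZ : has_covariance Q Z Sigma) (Sigma_ge : forall j, c <= Sigma j j).

Definition kernel_error (w : T) : R :=
  \big[Num.max/0]_(j < p) \big[Num.max/0]_(k < p) `|tau (V w) j k - Sigma j k|.

Lemma measurable_kernel_error : measurable_fun [set: T] kernel_error.
Proof.
apply: measurable_bigmaxr => j; apply: measurable_bigmaxr => k.
apply: measurableT_comp => //; apply: measurable_funB => //.
exact: measurable_kernel_entry Vtau j k.
Qed.

Lemma le_kernel_error j k w : `|tau (V w) j k - Sigma j k| <= kernel_error w.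
Proof.
apply: le_trans (le_bigmax _ (fun j => \big[Num.max/0]_(k < p)
  `|tau (V w) j k - Sigma j k|) j).
exact: (le_bigmax _ (fun k => `|tau (V w) j k - Sigma j k|) k).
Qed.

(** Dividing each coordinate by its Gaussian standard deviation gives unit variances and maps
    orthants to orthants, with the corner rescaled accordingly. The kernel error gets multiplied
    entrywise by lam_j lam_k <= 1 / c, the origin of the dependence on c. *)
Lemma orthant_probability_diff (y : 'rV[R]_p) (delta : R) :
  P.-integrable [set: T] (EFin \o kernel_error) -> 0 < delta ->
  (`|P (orthant V y) - Q (orthant Z y)| <=
   (960 * pi ^+ 2 / c * \int[P]_w kernel_error w * (Num.sqrt (ln p%:R) ^+ 3 / delta) +
    408 * pi * (Num.sqrt (ln p%:R) * delta))%:E)%E.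
Proof.
move=> iM delta0.
have [m [A [b [d1 [T1 [P1 [N [gN lawZ]]]]]]]] := gZ.
have HX := std_normal_family_vector_coord gN.
pose Y := linear_image (vector_coord N) (fun i j => A i j).
pose lam j := (Num.sqrt (Sigma j j))^-1.
have S0 j : 0 < Sigma j j := lt_le_trans c_gt0 (Sigma_ge j).
have lam0 j : 0 < lam j by rewrite invr_gt0 sqrtr_gt0.
have lamc1 j : lam j <= (Num.sqrt c)^-1.
  by rewrite lef_pV2 ?posrE ?sqrtr_gt0// ler_wsqrtr.
have lam2 j k : 0 <= lam j * lam k by rewrite mulr_ge0// ltW.
have lamc j k : lam j * lam k <= c^-1.
  by rewrite -(sqr_sqrtr (ltW c_gt0)) expr2 invfM ler_pM// ltW.
pose a i j := A i j * lam j.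
have gramE j k : gram a j k = lam j * lam k * Sigma j k.
  rewrite -(gaussian_vector_covariance gN lawZ cZ sZ) /gram big_distrr/=.
  by apply: eq_bigr => i _; rewrite /a; ring.
have gram1 j : gram a j j = 1.
  rewrite gramE -invfM -expr2 sqr_sqrtr ?(ltW (S0 j))//.
  by rewrite mulVf ?gt_eqF.
have YE j w : linear_image (vector_coord N) a j w = lam j * Y j w.
  rewrite /Y /linear_image big_distrr/=.
  by apply: eq_bigr => i _; rewrite /a; ring.
pose v j w := lam j * (V w : 'rV[R]_p) ord0 j.
pose tau' j k w := lam j * lam k * tau (V w) j k.
pose D w := c^-1 * kernel_error w.
have iv j : P.-integrable [set: T] (EFin \o v j).
  exact: integrableZl (cV j).1.
have mtau j k : measurable_fun [set: T] (tau' j k).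
  by apply: measurable_funM => //; exact: measurable_kernel_entry Vtau j k.
have iD : P.-integrable [set: T] (EFin \o D) by exact: integrableZl iM.
have tauD j k w : `|tau' j k w - gram a j k| <= D w.
  rewrite gramE /tau' -mulrBr normrM (ger0_norm (lam2 j k)).
  by rewrite ler_pM// le_kernel_error.
have p_gt0 : (0 < p)%N by exact: leq_trans p_ge2.
have stein beta del (beta0 : 0 < beta) (del0 : 0 < del) c' b' (c'0 : c' != 0) :=
  stein_test_fun p_gt0 beta0 del0 Vtau lam b' c'0.
pose eta k := lam k * y ord0 k.
have /= := orthant_distance_le HX p_ge2 gram1 iv mtau iD tauD stein eta delta0.
have PE : P (orthant V y) = (\int[P]_w orthant_indicator (fun k => v k w - eta k))%:E.
  rewrite -probability_lower_orthant; last first.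
    by move=> k; apply: measurable_funB => //; case/integrableP: (iv k) => /measurable_EFinP.
  congr (P _); apply/seteqP; split => w /= H k; have := H k;
    by rewrite /v /eta -mulrBr pmulr_rle0// subr_le0.
have QE : Q (orthant Z y) =
    (\int[P1]_w orthant_indicator (fun k => linear_image (vector_coord N) a k w - eta k))%:E.
  rewrite (orthant_gaussian_vector gN lawZ cZ) -probability_lower_orthant; last first.
    by move=> k; apply: measurable_funB => //; exact: measurable_linear_image HX k.
  congr (P1 _); apply/seteqP; split => w /= H k; have := H k;
    by rewrite YE /eta -mulrBr pmulr_rle0// subr_le0.
rewrite PE QE -EFinB abse_EFin lee_fin => H; apply: le_trans H _.
rewrite /D RintegralZl//.
by rewrite !mulrA.
Qed.

End kolmogorov_bound.

Theorem theorem3p2 (R : realType) (c : R) (c_gt0 : 0 < c) :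
  exists C : R,
  forall (p : nat) (p_ge2 : (2 <= p)%N)
    (d : measure_display) (T : measurableType d) (P : probability T R)
    (V : {RV P >-> borelV R p}) (tau : 'rV[R]_p -> 'M[R]_p)
    (d' : measure_display) (T' : measurableType d') (Q : probability T' R)
    (Z : {RV Q >-> borelV R p}) (Sigma : 'M[R]_p),
    centered P V ->
    stein_kernel P V tau ->
    gaussian_vector Q Z ->
    centered Q Z ->
    has_covariance Q Z Sigma ->
    (forall j : 'I_p, c <= Sigma j j) ->
    (kolmogorov_dist P V Q Z <=
       C%:E * (stein_discrepancy P V tau Sigma * (ln (p%:R : R) ^+ 2)%:E)
                `^ (2^-1)%R)%E.
Proof.
have pi2 : 0 < (pi : R) := pi_gt0 R.
have A0 : 0 < 960 * pi ^+ 2 / c.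
  apply: divr_gt0 c_gt0; apply: mulr_gt0; first by rewrite ltr0n.
  exact: exprn_gt0.
have B0 : 0 < 408 * pi :> R by apply: mulr_gt0; first by rewrite ltr0n.
exists (960 * pi ^+ 2 / c + 408 * pi) => p p_ge2 d T P V tau d' T' Q Z Sigma.
move=> cV Vtau gZ cZ sZ Sigma_ge.
have lnp0 : 0 < ln p%:R :> R by have := ln_dim_ge R p_ge2; lra.
have l0 := sqrt_ln_dim_gt0 R p_ge2; have l2 := sqr_sqrt_ln_dim R p_ge2.
apply: ge_ereal_sup => _ [y _ <-].
have mM := measurable_kernel_error Sigma Vtau.
have M0 w : 0 <= kernel_error V tau Sigma w := bigmax_ge_id _ _ _ _.
have -> : stein_discrepancy P V tau Sigma = (\int[P]_w (kernel_error V tau Sigma w)%:E)%E.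
  by rewrite /stein_discrepancy unlock.
have I0 : (0 <= \int[P]_w (kernel_error V tau Sigma w)%:E)%E.
  by apply: integral_ge0 => w _; rewrite lee_fin.
(* An infinite discrepancy makes the right side infinite, as ln p and the constant are positive. *)
have [Ioo|Ioo] := leP +oo%E (\int[P]_w (kernel_error V tau Sigma w)%:E)%E.
  move: Ioo; rewrite leye_eq => /eqP ->.
  by rewrite gt0_mulye ?lte_fin ?exprn_gt0// poweRyr// gt0_muley ?lte_fin ?(addr_gt0 A0 B0)// leey.
have iM : P.-integrable [set: T] (EFin \o kernel_error V tau Sigma).
  apply/integrableP; split; first exact/measurable_EFinP.
  by under eq_integral do rewrite /= ger0_norm//.
have -> : (\int[P]_w (kernel_error V tau Sigma w)%:E)%E =
    (\int[P]_w kernel_error V tau Sigma w)%:E.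
  by rewrite /Rintegral fineK// integrable_fin_num.
rewrite -[X in (X `^ _)%E]EFinM poweR_EFin powR12_sqrt; last first.
  by rewrite mulr_ge0 ?sqr_ge0// Rintegral_ge0.
rewrite -EFinM -l2.
have H (delta : R) (delta0 : 0 < delta) := orthant_probability_diff c_gt0 p_ge2 cV Vtau gZ cZ sZ Sigma_ge y iM delta0.
(* Finite by the bound at scale 1, which brings the optimization over delta back to the reals. *)
have fP : (`|P (orthant V y) - Q (orthant Z y)| \is a fin_num)%E.
  by rewrite ge0_fin_numE ?abse_ge0//; exact: le_lt_trans (H 1 ltr01) (ltry _).
rewrite -(fineK fP) lee_fin.
apply: (optimal_scale (ltW A0) (ltW B0) l0); first exact: Rintegral_ge0.
by move=> delta delta0; rewrite -lee_fin fineK//; exact: H.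
Qed.
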